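(* Let $K\subset\mathbb{E}^3$ be a compact convex set with mean curvature integral $M$ and volume $V$. Then $$M^{3}-\pi^{4}V=\int_{P\notin K}\beta(\Omega(P))\,dP .$$
   Context: $\mathbb{E}^3$ is Euclidean 3-space, $dP$ is Lebesgue measure on $\mathbb{E}^3$, $S^2$ is the unit sphere, and $dv,dv_i$ denote the surface (Lebesgue) measure on $S^2$. Convex sets are nonempty. For $P\notin K$, the visual solid angle $\Omega(P)\subset S^2$ of $K$ from $P$ is the set of unit vectors $u$ such that the ray $\{P+tu: t\ge 0\}$ meets $K$; it is a spherically convex set. For a spherically convex set $\Omega\subset S^2$, $\tilde\Omega=\{v\in S^2 : v^{\perp}\cap\Omega\neq\emptyset\}$, where $v^\perp$ is the plane through the origin orthogonal to $v$, and $$\beta(\Omega)=\frac18\int_{v_1,v_2,v_3\in\tilde\Omega}|\det(v_1,v_2,v_3)|\,dv_1\,dv_2\,dv_3 .$$ The mean curvature integral $M$ is the integral of the mean curvature over $\partial K$ when $\partial K$ is smooth; for a general compact convex set, $M=\int_{S^2}p(u)\,du$ with $p(u)=\max_{x\in K}\langle x,u\rangle$ the support function. *)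

(* Defs.v *)
From HB Require Import structures.
From mathcomp Require Import all_boot all_order all_algebra.
From mathcomp Require Import all_classical all_reals all_analysis.
From mathcomp Require Import measurable_realfun.
From mathcomp Require Import ring.

Set Implicit Arguments.
Unset Strict Implicit.
Unset Printing Implicit Defensive.

Import Order.TTheory GRing.Theory Num.Theory numFieldNormedType.Exports.

Local Open Scope classical_set_scope.
Local Open Scope ring_scope.

(* The topology, the vector space structure and the sigma-algebra are those of
   the product.  The norm [`|_|] that the library puts on this type is the max
   norm; the Euclidean one is [enorm]. *)
Notation E3 R := ((R * R) * R)%type.

Definition dot (R : realType) (x y : E3 R) : R :=
  x.1.1 * y.1.1 + x.1.2 * y.1.2 + x.2 * y.2.

Definition enorm (R : realType) (x : E3 R) : R := Num.sqrt (dot x x).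

Definition sphere (R : realType) : set (E3 R) := [set u | enorm u = 1].
Arguments sphere R : clear implicits.

Definition coords (R : realType) (x : E3 R) : 'rV[R]_3 :=
  \row_(j < 3) [:: x.1.1; x.1.2; x.2]`_j.

Definition det3 (R : realType) (u v w : E3 R) : R :=
  \det (\matrix_(i < 3) coords [:: u; v; w]`_i).

(* [lebesgue_measure] lives on [measurableTypeR R], which has the same
   measurable sets as [R] but another display. *)
Definition leb (R : realType) : set R -> \bar R := @lebesgue_measure R.

Section leb_is_measure.
Variable R : realType.

Let leb0 : leb (@set0 R) = 0%E.
Proof. exact: (measure0 (@lebesgue_measure R)). Qed.

Let leb_ge0 (A : set R) : (0 <= leb A)%E.
Proof. exact: (measure_ge0 (@lebesgue_measure R)). Qed.

Let leb_sigma_additive : semi_sigma_additive (@leb R).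
Proof. exact: (@measure_semi_sigma_additive _ _ _ (@lebesgue_measure R)). Qed.

HB.instance Definition _ :=
  isMeasure.Build _ _ _ (@leb R) leb0 leb_ge0 leb_sigma_additive.

Let leb_sigma_finite : sigma_finite setT (@leb R).
Proof. exact: (sigma_finiteT (@lebesgue_measure R)). Qed.

HB.instance Definition _ :=
  Measure_isSigmaFinite.Build _ _ _ (@leb R) leb_sigma_finite.

End leb_is_measure.

Definition vol (R : realType) : set (E3 R) -> \bar R :=
  ((@leb R \x @leb R) \x @leb R)%E.

Section vol_is_measure.
Variable R : realType.

Let prod : {measure set (E3 R) -> \bar R} :=
  ((@leb R \x @leb R) \x @leb R)%E.

Let vol0 : vol (@set0 (E3 R)) = 0%E.
Proof. exact: (measure0 prod). Qed.

Let vol_ge0 (A : set (E3 R)) : (0 <= vol A)%E.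
Proof. exact: (measure_ge0 prod). Qed.

Let vol_sigma_additive : semi_sigma_additive (@vol R).
Proof. exact: (@measure_semi_sigma_additive _ _ _ prod). Qed.

HB.instance Definition _ :=
  isMeasure.Build _ _ _ (@vol R) vol0 vol_ge0 vol_sigma_additive.

End vol_is_measure.

(* Surface measure of the unit sphere, as a measure on [E3 R] carried by
   [sphere R]: the area of [A] is 3 times the volume of the solid cone with
   apex 0 over [A], so that Lebesgue measure is r^2 dr dv in polar
   coordinates. *)
Definition surface_measure (R : realType) (A : set (E3 R)) : \bar R :=
  (3%:E * vol [set (t *: u : E3 R) | t in `]0%R, 1%R] & u in sphere R `&` A])%E.

Section surface_measure_is_measure.
Variable R : realType.

Let m1 : measurable_fun [set: E3 R] (fun x => x.1.1).
Proof. exact: measurableT_comp measurable_fst measurable_fst. Qed.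

Let m2 : measurable_fun [set: E3 R] (fun x => x.1.2).
Proof. exact: measurableT_comp measurable_snd measurable_fst. Qed.

Let m3 : measurable_fun [set: E3 R] (fun x => x.2).
Proof. exact: measurable_snd. Qed.

Let measurable_enorm : measurable_fun setT (@enorm R).
Proof.
apply: measurableT_comp.
  by apply: continuous_measurable_fun; exact: sqrt_continuous.
by apply: measurable_funD; [apply: measurable_funD|]; exact: measurable_funM.
Qed.

Let enorm_ge0 (x : E3 R) : 0 <= enorm x.
Proof. exact: sqrtr_ge0. Qed.

Let enormZ (t : R) (x : E3 R) : 0 <= t -> enorm (t *: x) = t * enorm x.
Proof.
move=> t0; rewrite /enorm (_ : dot (t *: x) (t *: x) = t ^+ 2 * dot x x).
  by rewrite sqrtrM ?sqr_ge0// sqrtr_sqr ger0_norm.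
by rewrite /dot /=; change (@GRing.scale _ _) with (@GRing.mul R); ring.
Qed.

Let direction (x : E3 R) : E3 R := (enorm x)^-1 *: x.

Let measurable_direction : measurable_fun setT direction.
Proof.
have mV : measurable_fun setT (fun x : E3 R => (enorm x)^-1).
  rewrite (_ : (fun x => _) = (fun x : E3 R => enorm x `^ (-1))).
    exact: measurableT_comp (measurable_powR _) measurable_enorm.
  by apply/funext => x; rewrite powR_inv1.
by apply: measurable_fun_pair; [apply: measurable_fun_pair|];
  exact: measurable_funM.
Qed.

Let ball0 : set (E3 R) := [set x | 0 < enorm x <= 1].

Let measurable_ball0 : measurable ball0.
Proof.
rewrite (_ : ball0 = setT `&` @enorm R @^-1` `]0, 1]).
  by apply: measurable_enorm => //; exact: measurable_itv.
by apply/seteqP; split => x /=; rewrite in_itv/= => // -[].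
Qed.

Let coneE (A : set (E3 R)) :
  [set (t *: u : E3 R) | t in `]0%R, 1%R] & u in sphere R `&` A] =
  direction @^-1` A `&` ball0.
Proof.
apply/seteqP; split => [x [t /= + [u [Su Au] <-]]|x [Ax /andP[x0 x1]]].
  rewrite in_itv/= => /andP[t0 t1].
  have Ntu : enorm (t *: u) = t by rewrite enormZ ?ltW// Su mulr1.
  rewrite /direction /ball0 /= Ntu scalerA mulVf ?gt_eqF// scale1r.
  by split => //; rewrite t0.
exists (enorm x); first by rewrite /= in_itv/= x0.
exists (direction x); last by rewrite /direction scalerA mulfV ?gt_eqF// scale1r.
split => //=.
by rewrite /sphere /= enormZ ?invr_ge0// mulVf// gt_eqF.
Qed.

Let m : {measure set (E3 R) -> \bar R} :=
  mscale 3%:nng (measure_function_pushforward__canonical__measure_function_Measure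
    (mrestr (@vol R) measurable_ball0) measurable_direction).

Let surface_measureE : @surface_measure R = m.
Proof. by apply/funext => A; rewrite /surface_measure coneE. Qed.

Let surface_measure0 : surface_measure (@set0 (E3 R)) = 0%E.
Proof. by rewrite surface_measureE measure0. Qed.

Let surface_measure_ge0 (A : set (E3 R)) : (0 <= surface_measure A)%E.
Proof. by rewrite surface_measureE measure_ge0. Qed.

Let surface_measure_sigma_additive : semi_sigma_additive (@surface_measure R).
Proof. by rewrite surface_measureE; exact: measure_semi_sigma_additive. Qed.

HB.instance Definition _ := isMeasure.Build _ _ _ (@surface_measure R)
  surface_measure0 surface_measure_ge0 surface_measure_sigma_additive.

End surface_measure_is_measure.

(* The supremum is a maximum when [K] is nonempty and compact. *)
Definition support_function (R : realType) (K : set (E3 R)) (u : E3 R) : R :=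
  sup [set dot x u | x in K].

(* Definition for an arbitrary compact convex set; it is the integral of the
   mean curvature over the boundary when the latter is smooth. *)
Definition mean_curvature_integral (R : realType) (K : set (E3 R)) : R :=
  \int[@surface_measure R]_(u in sphere R) support_function K u.

Definition visual_solid_angle (R : realType) (K : set (E3 R)) (P : E3 R) :
    set (E3 R) :=
  [set u | sphere R u /\ [set P + t *: u | t in `[0, +oo[] `&` K !=set0].

Definition orthogonal_plane (R : realType) (v : E3 R) : set (E3 R) :=
  [set x | dot x v = 0].

Definition omega_tilde (R : realType) (Omega : set (E3 R)) : set (E3 R) :=
  [set v | sphere R v /\ orthogonal_plane v `&` Omega !=set0].

Definition beta (R : realType) (Omega : set (E3 R)) : \bar R :=
  ((8^-1)%:E * \int[@surface_measure R]_(v1 in omega_tilde Omega)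
               \int[@surface_measure R]_(v2 in omega_tilde Omega)
               \int[@surface_measure R]_(v3 in omega_tilde Omega)
                 `|det3 v1 v2 v3|%:E)%E.

(* Main.v *)
Require Import Defs.
From HB Require Import structures.
From mathcomp Require Import all_boot all_order all_algebra.
From mathcomp Require Import all_classical all_reals all_analysis.
From mathcomp Require Import measurable_realfun.
From mathcomp Require Import ring lra.

(** The theorem comes from measuring triples of planes that meet K in two ways.

    Let h be the support function of K.  A plane orthogonal to the unit vector
    v is the level set {x | x . v = c}; it meets K exactly when c lies in the
    interval [- h (- v), h v], whose length is the width w v = h v + h (- v).
    The surface measure is invariant under v |-> - v, so the integral of w over
    the sphere is 2 M, and 8 M^3 is the integral of w v1 * w v2 * w v3 over all
    triples of unit vectors.

    If v1, v2, v3 are linearly independent, P |-> (P . v1, P . v2, P . v3) is a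
    linear isomorphism with determinant det3 v1 v2 v3, so w v1 * w v2 * w v3 is
    |det3 v1 v2 v3| times the volume of the set of points P such that for each i
    the plane through P orthogonal to vi meets K (volume_parallelepiped, from
    the change of variables vol_linear).  Linearly dependent triples form a
    null set (surface_measure_poles, surface_measure_great_circle).  Exchanging
    the integrations gives
      8 M^3 = int_P int int int |det3 v1 v2 v3| dv1 dv2 dv3 dP,
    where for each P the vi range over the unit vectors whose orthogonal plane
    through P meets K (mean_curvature_cube_triples).

    For P in K this is no condition, and the triple integral is the constant
    8 pi^4 (integral_det3); the points of K contribute 8 pi^4 V.  For P outside
    K the condition says that vi belongs to the set omega_tilde of the visual
    solid angle at P (omega_tildeE), and the triple integral is 8 beta.
    Dividing by 8 gives the theorem.

    The constant 8 pi^4 comes from integrating over v3, then v2, then v1: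
      int |v3 . n| dv3 = 2 pi |n|   with n = v1 x v2,
      int |v1 x v2| dv2 = pi^2   for |v1| = 1,   and   int dv1 = 4 pi.
    The first two integrands depend only on the inner product with one vector;
    by invariance of the surface measure under reflections this vector may be
    taken on a coordinate axis (surface_zonal).  What is left are integrals of
    even functions, computed in gnomonic coordinates (surface_gnomonic), where
    they become products of integrals over the line. *)

Set Implicit Arguments.
Unset Strict Implicit.
Unset Printing Implicit Defensive.

Import Order.TTheory GRing.Theory Num.Theory numFieldNormedType.Exports.

Local Open Scope classical_set_scope.
Local Open Scope ring_scope.

(** * Vectors of Euclidean 3-space *)

Section vectors.
Context (R : realType).
Local Notation S2 := (sphere R).
Implicit Types (u v w x y P : E3 R) (a t : R).

Lemma scaleE3 a u : a *: u = (a * u.1.1, a * u.1.2, a * u.2) :> E3 R.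
Proof. by []. Qed.

Lemma oppE3 u : - u = (- u.1.1, - u.1.2, - u.2) :> E3 R.
Proof. by []. Qed.

Lemma addE3 u v : u + v = (u.1.1 + v.1.1, u.1.2 + v.1.2, u.2 + v.2) :> E3 R.
Proof. by []. Qed.

Lemma dotC u v : dot u v = dot v u.
Proof. by rewrite /dot; ring. Qed.

Lemma dotZl (t : R) u v : dot (t *: u) v = t * dot u v.
Proof. by rewrite scaleE3 /dot/=; ring. Qed.

Lemma dotZr a u v : dot u (a *: v) = a * dot u v.
Proof. by rewrite dotC dotZl dotC. Qed.

Lemma dotDl u u' v : dot (u + u') v = dot u v + dot u' v.
Proof. by rewrite /dot /=; ring. Qed.

Lemma dotNl u v : dot (- u) v = - dot u v.
Proof. by rewrite /dot/=; ring. Qed.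

Lemma dotNr u v : dot u (- v) = - dot u v.
Proof. by rewrite /dot/=; ring. Qed.

Lemma dot_ge0 u : 0 <= dot u u.
Proof. by rewrite /dot !addr_ge0// -expr2 sqr_ge0. Qed.

Lemma enormE u : enorm u ^+ 2 = dot u u.
Proof. by rewrite /enorm sqr_sqrtr// dot_ge0. Qed.

Lemma enorm_ge0 u : 0 <= enorm u.
Proof. exact: sqrtr_ge0. Qed.

Lemma enormZ (t : R) u : enorm (t *: u) = `|t| * enorm u.
Proof.
rewrite /enorm dotZl dotC dotZl mulrA -expr2.
by rewrite sqrtrM ?sqr_ge0// sqrtr_sqr.
Qed.

Lemma enorm_eq0 (n : E3 R) : enorm n = 0%R -> n = 0%R.
Proof.
move=> n0; have : dot n n = 0%R by rewrite -enormE n0 expr0n.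
case: n {n0} => [[a b] c]; rewrite /dot/= => n0.
have a0 : (a = 0)%R by nra.
have b0 : (b = 0)%R by nra.
have c0 : (c = 0)%R by nra.
by rewrite a0 b0 c0.
Qed.

Lemma sphereP u : S2 u <-> dot u u = 1.
Proof.
rewrite /sphere /=; split=> [u1|]; first by rewrite -enormE u1 expr1n.
by rewrite /enorm => ->; rewrite sqrtr1.
Qed.

Lemma sphereN u : S2 (- u)%R <-> S2 u.
Proof. by rewrite !sphereP /dot/= !mulrNN. Qed.

Lemma sphere_coord u : S2 u -> [/\ `|u.1.1| <= 1, `|u.1.2| <= 1 & `|u.2| <= 1].
Proof.
move=> /sphereP; rewrite /dot => u1.
by split; rewrite -(ler_pXn2r (_ : 0 < 2)%N) ?nnegrE// expr1n real_normK ?num_real//; nra.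
Qed.

Definition direction (x : E3 R) : E3 R := (enorm x)^-1 *: x.

Lemma direction_sphere x : enorm x != 0 -> S2 (direction x).
Proof.
by move=> x0; rewrite /sphere/= enormZ ger0_norm ?invr_ge0 ?enorm_ge0// mulVf.
Qed.

Lemma unitize (n : E3 R) : enorm n != 0%R -> exists2 m, S2 m & n = enorm n *: m.
Proof.
move=> n0; exists (direction n); first exact: direction_sphere.
by rewrite /direction scalerA mulfV// scale1r.
Qed.

(** Punctured, because directions are meaningless at the origin. *)
Definition pball : set (E3 R) := [set x | 0 < enorm x <= 1].

Lemma det3E u v w : det3 u v w =
  u.1.1 * (v.1.2 * w.2 - v.2 * w.1.2) - u.1.2 * (v.1.1 * w.2 - v.2 * w.1.1)
  + u.2 * (v.1.1 * w.1.2 - v.1.2 * w.1.1).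
Proof.
rewrite /det3 (expand_det_row _ ord0) !big_ord_recl big_ord0 /cofactor.
rewrite !(expand_det_row _ ord0) !big_ord_recl !big_ord0 /cofactor !det_mx11.
by rewrite !mxE/= /bump/= !expr0 !expr1 ?sqrrN ?expr1n !addr0 -?signr_odd /= ?expr0 ?expr1; ring.
Qed.

Definition cross u v : E3 R :=
  (u.1.2 * v.2 - u.2 * v.1.2, u.2 * v.1.1 - u.1.1 * v.2,
   u.1.1 * v.1.2 - u.1.2 * v.1.1)%R.

Lemma det3_cross u v w : det3 u v w = dot w (cross u v).
Proof. by rewrite det3E /dot/=; ring. Qed.

(** Lagrange's identity. *)
Lemma dot_cross u v :
  dot (cross u v) (cross u v) = (dot u u * dot v v - dot v u ^+ 2)%R.
Proof. by rewrite /dot/=; ring. Qed.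

Lemma enorm_cross u v : S2 u -> S2 v -> enorm (cross u v) = Num.sqrt (1 - dot v u ^+ 2).
Proof.
move=> /sphereP u1 /sphereP v1; rewrite /enorm; congr Num.sqrt.
by rewrite dot_cross u1 v1 mulr1.
Qed.

End vectors.

(** * Measurable functions and sets *)

(** Measurability of compositions of projections, pairings, sums, products and
    functions assumed measurable.  The lemma to apply is read off the syntax,
    because leaving the choice to unification would unfold the measurable
    structures of the nested products. *)
Ltac meas := repeat match goal with
 | |- measurable_fun _ (fun _ => (_ , _)) => apply: measurable_fun_pair
 | |- measurable_fun _ (fun _ => (_ + _)%R) => apply: measurable_funD
 | |- measurable_fun _ (fun _ => (_ * _)%R) => apply: measurable_funM
 | |- measurable_fun _ (fun p => (- @?g p)%R) =>
   apply: (@measurable_funN _ _ _ _ g)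
 | |- measurable_fun _ (fun x => x) => exact: measurable_id
 | |- measurable_fun _ fst => exact: measurable_fst
 | |- measurable_fun _ snd => exact: measurable_snd
 | |- measurable_fun _ (fun p => fst (@?g p)) =>
   apply: (@measurableT_comp _ _ _ _ _ _ fst _ g); [exact: measurable_fst|]
 | |- measurable_fun _ (fun p => snd (@?g p)) =>
   apply: (@measurableT_comp _ _ _ _ _ _ snd _ g); [exact: measurable_snd|]
 | |- measurable_fun _ (fun _ => ?c) => exact: measurable_cst
 | H : measurable_fun _ ?f |- measurable_fun _ ?f => exact: H
 | H : measurable_fun _ ?f |- measurable_fun _ (fun p => ?f (@?g p)) =>
   apply: (@measurableT_comp _ _ _ _ _ _ f _ g); [exact: H|]
 end.

Section measurability.
Context (R : realType).
Local Notation S2 := (sphere R).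
Local Notation direction := (@direction R).
Local Notation pball := (@pball R).
Implicit Types (u v w P : E3 R).

(** The inverse is not continuous at 0, but it is a real power. *)
Lemma measurable_invr d (T : measurableType d) (f : T -> R) :
  measurable_fun setT f -> (forall p, 0 <= f p) ->
  measurable_fun setT (fun p : T => (f p)^-1).
Proof.
move=> mf f0.
rewrite (_ : (fun p => _) = (fun p => f p `^ (-1))).
  exact: measurableT_comp (measurable_powR _) mf.
by apply/funext => p; rewrite powR_inv1.
Qed.

Lemma measurable_opp : measurable_fun setT (fun u : E3 R => - u).
Proof.
rewrite (_ : (fun u => - u) = fun u : E3 R => (- u.1.1, - u.1.2, - u.2)); last first.
  by apply/funext => u; rewrite oppE3.
by meas.
Qed.

Lemma measurable_dotl u : measurable_fun setT (fun P => dot P u).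
Proof. by rewrite /dot; meas. Qed.

Lemma measurable_dot_preimage (A : set R) u :
  measurable A -> measurable [set v | A (dot v u)].
Proof.
move=> mA; rewrite -[X in measurable X]setTI.
exact: (measurable_dotl u measurableT mA).
Qed.

Lemma measurable_sqr_eq1 : measurable [set x : R | x ^+ 2 = 1].
Proof.
rewrite -[X in measurable X]setTI.
have mX : measurable_fun setT (fun x : R => x ^+ 2).
  by apply: measurable_funX; exact: measurable_id.
exact: (mX measurableT [set 1] (measurable_set1 1)).
Qed.

Lemma measurable_det3 d (T : measurableType d) (F G H : T -> E3 R) :
  measurable_fun setT F -> measurable_fun setT G -> measurable_fun setT H ->
  measurable_fun setT (fun x : T => det3 (F x) (G x) (H x)).
Proof.
move=> mF mG mH.
rewrite (_ : (fun x => _) = fun x =>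
    (F x).1.1 * ((G x).1.2 * (H x).2 - (G x).2 * (H x).1.2)
  - (F x).1.2 * ((G x).1.1 * (H x).2 - (G x).2 * (H x).1.1)
  + (F x).2 * ((G x).1.1 * (H x).1.2 - (G x).1.2 * (H x).1.1)); last first.
  by apply/funext => x; exact: det3E.
by meas.
Qed.

Lemma measurable_enorm : measurable_fun setT (@enorm R).
Proof.
rewrite /enorm; apply: measurableT_comp.
  by apply: continuous_measurable_fun; exact: sqrt_continuous.
by rewrite /dot; meas.
Qed.

Lemma measurable_sphere : measurable S2.
Proof.
rewrite (_ : S2 = setT `&` @enorm R @^-1` [set 1]); last first.
  by rewrite setTI.
by apply: measurable_enorm.
Qed.

Lemma measurable_direction : measurable_fun setT direction.
Proof.
have mV := measurable_invr measurable_enorm (@enorm_ge0 R); rewrite /direction.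
by do 2?[apply: measurable_fun_pair]; apply: measurable_funM => //; meas.
Qed.

Lemma measurable_pball : measurable pball.
Proof.
rewrite (_ : pball = setT `&` @enorm R @^-1` `]0, 1]).
  by apply: measurable_enorm => //; exact: measurable_itv.
by apply/seteqP; split => x /=; rewrite in_itv/= => // -[].
Qed.

(** An open set is a union of boxes with rational centre and half-side 1/(n+1),
    and there are countably many of those. *)
Lemma open_measurable_E3 (U : set (E3 R)) : open U -> measurable U.
Proof.
move=> oU; pose I := (rat * rat * rat * nat)%type.
pose B (i : I) : set (E3 R) :=
  (ball (ratr i.1.1.1 : R) i.2.+1%:R^-1 `*` ball (ratr i.1.1.2 : R) i.2.+1%:R^-1)
    `*` ball (ratr i.1.2 : R) i.2.+1%:R^-1.
pose F (i : I) := if pselect (B i `<=` U) then B i else set0.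
have mF i : measurable (F i).
  rewrite /F; case: (pselect _) => sub /=; last exact: measurable0.
  by apply: measurableX; [apply: measurableX|]; exact: measurable_ball.
suff -> : U = \bigcup_i F i.
  by apply: countable_bigcupT_measurable => //; exact: countableP.
apply/seteqP; split => [P UP|P [i _]]; last by rewrite /F; case: (pselect _) => sub //= /sub.
have /nbhs_ballP[e /= e0 Pe] : nbhs P U by exact: open_nbhs_nbhs.
have [n ne] : exists n : nat, n.+1%:R^-1 < e / 2.
  have e2 : 0 < e / 2 by rewrite divr_gt0.
  exists (Num.truncn (e / 2)^-1); rewrite invf_plt ?posrE// ?ltr0n//.
  exact: truncnS_gt.
have n0 : 0 < n.+1%:R^-1 :> R by rewrite invr_gt0.
have appr (a d : R) : 0 < d -> exists q : rat, `|ratr q - a| < d.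
  move=> d0; have /rat_in_itvoo[q] : a - d < a + d.
    by rewrite ltrBlDr -addrA ltrDl addr_gt0.
  rewrite in_itv/= => /andP[p1 p2]; exists q.
  by rewrite ltr_norml; apply/andP; split; lra.
have [q1 Pq1] := appr P.1.1 _ n0; have [q2 Pq2] := appr P.1.2 _ n0.
have [q3 Pq3] := appr P.2 _ n0.
exists ((q1, q2, q3), n) => //; rewrite /F; case: (pselect _) => [sub|]/=.
  by split; [split|]; rewrite /ball/=.
case=> Q [[/= b1 b2] b3]; apply: Pe; rewrite /ball/=.
have tri (a b c d : R) : d < e / 2 -> `|c - a| < d -> ball c d b -> ball a e b.
  rewrite /ball/= => de ca cb.
  have -> : a - b = (c - b) - (c - a) by ring.
  by apply: (le_lt_trans (ler_normB _ _)); lra.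
by split; [split|]; [exact: tri ne Pq1 b1|exact: tri ne Pq2 b2|exact: tri ne Pq3 b3].
Qed.

Lemma continuous_dotr x : continuous (fun u => dot x u).
Proof.
have c1 : continuous (fun u : E3 R => u.1.1).
  by move=> u; apply: (@cvg_comp _ _ _ fst fst _ (nbhs u.1)); exact: cvg_fst.
have c2 : continuous (fun u : E3 R => u.1.2).
  by move=> u; apply: (@cvg_comp _ _ _ fst snd _ (nbhs u.1)); [exact: cvg_fst|exact: cvg_snd].
have c3 : continuous (fun u : E3 R => u.2) by move=> u; exact: cvg_snd.
move=> u; apply: cvgD; first apply: cvgD.
- by apply: cvgMr; exact: c1.
- by apply: cvgMr; exact: c2.
- by apply: cvgMr; exact: c3.
Qed.

Lemma continuous_dotl x : continuous (fun u => dot u x).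
Proof.
rewrite (_ : (fun u => _) = (fun u => dot x u)); first exact: continuous_dotr.
by apply/funext => u; rewrite dotC.
Qed.

End measurability.

(** * Integrals of nonnegative functions *)

Section ge0_integrals.
Context d (T : measurableType d) (R : realType) (m : {measure set T -> \bar R}).
Local Open Scope ereal_scope.

Lemma ge0_integral_mrestr (D : set T) (mD : measurable D) (f : T -> \bar R) :
  measurable_fun setT f -> (forall x, 0 <= f x) ->
  \int[mrestr m mD]_x f x = \int[m]_(x in D) f x.
Proof.
move=> mf f0.
have ND0 : mrestr m mD (~` D) = 0 by rewrite /mrestr setICl measure0.
rewrite (ge0_negligible_integral (measurableC mD) measurableT mf (fun x _ => f0 x) ND0).
rewrite setTD setCK.
by apply: eq_measure_integral => A mA AD; rewrite /= /mrestr setIidl.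
Qed.

Lemma ge0_integral_off_null (D N : set T) (f g : T -> \bar R) :
  measurable D -> measurable N -> m N = 0 ->
  measurable_fun setT f -> measurable_fun setT g ->
  (forall x, 0 <= f x) -> (forall x, 0 <= g x) ->
  (forall x, D x -> ~ N x -> f x = g x) ->
  \int[m]_(x in D) f x = \int[m]_(x in D) g x.
Proof.
move=> mD mN N0 mf mg f0 g0 fg.
rewrite (ge0_negligible_integral mN mD (measurable_funTS mf) (fun x _ => f0 x) N0).
rewrite (ge0_negligible_integral mN mD (measurable_funTS mg) (fun x _ => g0 x) N0).
by apply: eq_integral => x; rewrite inE => -[Dx Nx]; exact: fg.
Qed.

End ge0_integrals.

(** * Lebesgue measure on the line and affine substitutions *)

Section line.
Context (R : realType).
Local Notation mu := (@leb R).
Local Open Scope ereal_scope.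

(** By uniqueness of Lebesgue measure, it is enough to compare the two sides on
    half-open intervals. *)
Lemma leb_affine_set (a b : R) (A : set R) : (a != 0)%R -> measurable A ->
  leb A = `|a|%:E * leb [set x : R | A (a * x + b)%R].
Proof.
move=> a0 mA.
have mphi : measurable_fun [set: R] (fun x : R => (a * x + b)%R : measurableTypeR R).
  by apply: measurable_funD => //; exact: measurable_funM.
pose m : {measure set (measurableTypeR R) -> \bar R} :=
  mscale (NngNum (normr_ge0 a))
   (measure_function_pushforward__canonical__measure_function_Measure
      (@leb R) mphi).
rewrite /leb.
apply: (lebesgue_measure_unique (mu := m)) => // _ [[x y]] _ <-.
rewrite (_ : m _ = `|a|%:E * lebesgue_measure ((fun z : R => (a * z + b)%R : measurableTypeR R) @^-1` `]x, y]%classic)).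
rewrite lebesgue_measure_itv [X in if X then _ else _]/= lte_fin [(_ + _)%E]/=.
have [xy|yx] := ltP x y; last first.
  rewrite [_ @^-1` _](_ : _ = set0) ?measure0 ?mule0//.
  apply/seteqP; split => z //=; rewrite in_itv/= => /andP[h1 h2].
  by have := lt_le_trans h1 h2; rewrite ltNge yx.
have [ap|an|/eqP] := ltgtP 0%R a; last by rewrite eq_sym (negbTE a0).
  have -> : (fun z : R => (a * z + b)%R : measurableTypeR R) @^-1` `]x, y] =
      `]((x - b) / a)%R, ((y - b) / a)%R]%classic.
    apply/seteqP; split => z /=;
    by rewrite !in_itv/= ltr_pdivrMr// ler_pdivlMr// ltrBlDr lerBrDr (mulrC z).
  rewrite lebesgue_measure_itv/= lte_fin ltr_pM2r ?invr_gt0// ltrD2r xy.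
  rewrite gtr0_norm// -!EFinD -EFinM; congr EFin.
  by field.
(* A negative slope moves the closed end of the interval to the left. *)
have -> : (fun z : R => (a * z + b)%R : measurableTypeR R) @^-1` `]x, y] =
    `[((y - b) / a)%R, ((x - b) / a)%R[%classic.
  apply/seteqP; split => z /=;
  by rewrite !in_itv/= ltr_ndivlMr// ler_ndivrMr// ltrBlDr lerBrDr (mulrC z) andbC.
rewrite lebesgue_measure_itv/= lte_fin ltr_nM2r ?invr_lt0// ltrD2r xy.
  rewrite ltr0_norm// -!EFinD -EFinM; congr EFin.
  by field.
by [].
Qed.

Lemma leb_affine (a b : R) (f : R -> \bar R) : (a != 0)%R ->
  measurable_fun setT f -> (forall x, 0 <= f x) ->
  \int[@leb R]_x f x = `|a|%:E * \int[@leb R]_x f (a * x + b)%R.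
Proof.
move=> a0 mf f0.
have mphi : measurable_fun [set: R] (fun x : R => (a * x + b)%R).
  by apply: measurable_funD => //; exact: measurable_funM.
pose m : {measure set R -> \bar R} :=
  mscale (NngNum (normr_ge0 a))
   (measure_function_pushforward__canonical__measure_function_Measure
      (@leb R) mphi).
transitivity (\int[m]_x f x).
  by apply: eq_measure_integral => A mA _; exact: leb_affine_set.
rewrite ge0_integral_mscale//; congr (_ * _).
by rewrite ge0_integral_pushforward.
Qed.

Lemma leb_scale (a : R) (f : R -> R) : (0 < a)%R -> measurable_fun setT f ->
  (forall s, (0 <= f s)%R) ->
  \int[mu]_s (f s)%:E = a%:E * \int[mu]_s (f (a * s)%R)%:E.
Proof.
move=> a0 mf f0.
have mf' : measurable_fun setT (fun s => (f s)%:E) by apply/measurable_EFinP.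
rewrite (leb_affine 0 (lt0r_neq0 a0) mf' (fun s => f0 s)) gtr0_norm//.
by congr (_ * _); apply: eq_integral => s _; rewrite addr0.
Qed.

Lemma leb_itv_cc (a b : R) : (a <= b)%R -> leb `[a, b]%classic = (b - a)%:E.
Proof.
move=> ab; rewrite /leb lebesgue_measure_itv/= lte_fin.
by have [//|ba] := ltP a b; rewrite (le_anti (introT andP (conj ab ba))) subrr.
Qed.

Lemma leb_integralD1 (f : R -> \bar R) (a : R) :
  measurable_fun setT f -> (forall x, 0 <= f x) ->
  \int[mu]_x f x = \int[mu]_(x in ~` [set a]) f x.
Proof.
move=> mf f0; have N0 : mu [set a] = 0 by rewrite /leb lebesgue_measure_set1.
by rewrite (ge0_negligible_integral (measurable_set1 a) measurableT mf (fun x _ => f0 x) N0) setTD.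
Qed.

End line.

(** * Linear substitutions in space *)

Lemma sigma_finite_product_measure d1 d2 (T1 : measurableType d1)
    (T2 : measurableType d2) (R : realType)
    (m1 : {sigma_finite_measure set T1 -> \bar R})
    (m2 : {sigma_finite_measure set T2 -> \bar R}) :
  sigma_finite setT (m1 \x m2)%E.
Proof.
have /sigma_finiteP[F [FT ndF Ffin]] := sigma_finiteT m1.
have /sigma_finiteP[G [GT ndG Gfin]] := sigma_finiteT m2.
exists (fun n => F n `*` G n) => [|n]; last first.
  have [mF Foo] := Ffin n; have [mG Goo] := Gfin n.
  split; first exact: measurableX.
  by rewrite product_measure1E// lte_mul_pinfty// ge0_fin_numE.
apply/esym/seteqP; split=> // -[x y] _.
have [m _ Fx] : (\bigcup_i F i) x by rewrite -FT.
have [n _ Gy] : (\bigcup_i G i) y by rewrite -GT.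
exists (maxn m n) => //; split => /=.
- by move/subsetPset : (ndF _ _ (leq_maxl m n)); exact.
- by move/subsetPset : (ndG _ _ (leq_maxr m n)); exact.
Qed.

(** The product of Lebesgue measures on the plane, under a name of its own so
    that it can carry the sigma-finite structure required by Tonelli's
    theorem. *)
Definition area (R : realType) : set (R * R) -> \bar R := (@leb R \x @leb R)%E.

Section area_vol.
Variable R : realType.

HB.instance Definition _ := Measure.copy (@area R) (@leb R \x @leb R)%E.

HB.instance Definition _ := Measure_isSigmaFinite.Build _ _ _ (@area R)
  (sigma_finite_product_measure (@leb R) (@leb R)).

HB.instance Definition _ := Measure_isSigmaFinite.Build _ _ _ (@vol R)
  (sigma_finite_product_measure (@area R) (@leb R)).

End area_vol.

Section tonelli.
Context (R : realType).
Local Notation mu := (@leb R).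
Local Open Scope ereal_scope.

Lemma vol_box (A B C : set R) : measurable A -> measurable B -> measurable C ->
  vol ((A `*` B) `*` C) = (leb A * leb B * leb C)%E.
Proof.
move=> mA mB mC; rewrite -[LHS]/((@area R \x @leb R)%E _).
rewrite product_measure1E//; last exact: measurableX.
by rewrite -[X in (X * _)%E]/((@leb R \x @leb R)%E _) product_measure1E.
Qed.

Lemma vol_tonelli (f : E3 R -> \bar R) :
  measurable_fun setT f -> (forall x, 0 <= f x) ->
  \int[@vol R]_P f P = \int[mu]_x \int[mu]_y \int[mu]_z f (x, y, z).
Proof.
move=> mf f0.
transitivity (\int[(@area R \x mu)]_P f P); first by [].
rewrite (fubini_tonelli1 f)//.
transitivity (\int[(mu \x mu)]_p \int[mu]_z f (p, z)); first by [].
rewrite (fubini_tonelli1 (fun p => \int[mu]_z f (p, z)))//.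
- exact: (measurable_fun_fubini_tonelli_F f).
- by move=> p; exact: integral_ge0.
Qed.

Lemma leb_swap (f : R * R -> \bar R) :
  measurable_fun setT f -> (forall x, 0 <= f x) ->
  \int[mu]_x \int[mu]_y f (x, y) = \int[mu]_y \int[mu]_x f (x, y).
Proof. by move=> mf f0; exact: fubini_tonelli. Qed.

Lemma leb_swap12 (f : E3 R -> \bar R) :
  measurable_fun setT f -> (forall x, 0 <= f x) ->
  \int[mu]_x \int[mu]_y \int[mu]_z f (x, y, z) =
  \int[mu]_y \int[mu]_x \int[mu]_z f (x, y, z).
Proof.
move=> mf f0.
apply: (@leb_swap (fun p => \int[mu]_z f (p, z))).
- exact: (measurable_fun_fubini_tonelli_F f).
- by move=> p; exact: integral_ge0.
Qed.

Lemma leb_swap23 (f : E3 R -> \bar R) :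
  measurable_fun setT f -> (forall x, 0 <= f x) ->
  \int[mu]_x \int[mu]_y \int[mu]_z f (x, y, z) =
  \int[mu]_x \int[mu]_z \int[mu]_y f (x, y, z).
Proof.
move=> mf f0; apply: eq_integral => x _.
by apply: (@leb_swap (fun p => f (x, p.1, p.2))) => //; meas.
Qed.

Lemma measurable_int12 (f : E3 R -> \bar R) :
  measurable_fun setT f -> (forall x, 0 <= f x) ->
  measurable_fun setT (fun x => \int[mu]_y \int[mu]_z f (x, y, z)).
Proof.
move=> mf f0.
apply: (measurable_fun_fubini_tonelli_F (fun p => \int[mu]_z f (p, z))).
  exact: (measurable_fun_fubini_tonelli_F f).
by move=> p; exact: integral_ge0.
Qed.

End tonelli.

Section linear_substitutions.
Context (R : realType).
Local Notation mu := (@leb R).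
Implicit Types u v w P : E3 R.
Local Open Scope ereal_scope.

(** Gaussian elimination with pivot a: substitute in x for fixed y, then in y
    for fixed x.  The coefficient left for y is the Schur complement
    d - b c / a. *)
Let affine2_pivot (a b c d p q : R) (f : R * R -> \bar R) : (a != 0)%R ->
  (a * d - b * c != 0)%R -> measurable_fun setT f -> (forall x, 0 <= f x) ->
  \int[mu]_x \int[mu]_y f (x, y) = `|a * d - b * c|%:E *
  \int[mu]_x \int[mu]_y f (a * x + b * y + p, c * x + d * y + q)%R.
Proof.
move=> a0 D0 mf f0.
pose k (z : R * R) := f (a * z.1 + b * z.2 + p, c * z.1 + d * z.2 + q)%R.
have mk : measurable_fun setT k by rewrite /k; meas.
rewrite (leb_swap mk (fun=> f0 _)).
have E : (a * d - b * c = a * (d - b * c / a))%R by field.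
rewrite E normrM EFinM (muleC `|a|%:E) -muleA.
rewrite -ge0_integralZl; [|exact: measurableT| | |by rewrite lee_fin]; last 2 first.
- by apply: (measurable_fun_fubini_tonelli_G k mk) => z; exact: f0.
- by move=> y _; apply: integral_ge0 => x _; exact: f0.
pose g (z : R * R) := f (z.1, (c / a) * z.1 + (d - b * c / a) * z.2 + (q - c / a * p))%R.
have mg : measurable_fun setT g by rewrite /g; meas.
have g0 z : 0 <= g z by exact: f0.
have -> : \int[mu]_y (`|a|%:E * \int[mu]_x k (x, y)) =
    \int[mu]_y \int[mu]_x g (x, y).
  apply: eq_integral => y _.
  have mgy : measurable_fun setT (fun x => g (x, y)) by meas.
  rewrite [RHS](leb_affine (b * y + p) a0 mgy (fun=> g0 _)).
  congr (_ * _); apply: eq_integral => x _; rewrite /k /g/=; congr (f (_, _)).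
    by rewrite addrA.
  by field.
rewrite -(leb_swap mg g0).
rewrite -ge0_integralZl; [|exact: measurableT| | |by rewrite lee_fin]; last 2 first.
- exact: (measurable_fun_fubini_tonelli_F g).
- by move=> x _; exact: integral_ge0.
apply: eq_integral => x _.
have d0 : (d - b * c / a != 0)%R.
  by apply: contraNneq D0; rewrite E => ->; rewrite mulr0.
have mfx : measurable_fun setT (fun y => f (x, y)) by meas.
rewrite [LHS](leb_affine (c / a * x + (q - c / a * p)) d0 mfx (fun=> f0 _)).
by congr (_ * _); apply: eq_integral => y _; rewrite /g/=; congr (f (_, _)); ring.
Qed.

Lemma leb_affine2 (a b c d p q : R) (f : R * R -> \bar R) :
  (a * d - b * c != 0)%R -> measurable_fun setT f -> (forall x, 0 <= f x) ->
  \int[mu]_x \int[mu]_y f (x, y) = `|a * d - b * c|%:E *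
  \int[mu]_x \int[mu]_y f (a * x + b * y + p, c * x + d * y + q)%R.
Proof.
move=> D0 mf f0; have [a0|a0] := eqVneq a 0%R; last exact: affine2_pivot.
have b0 : (b != 0)%R.
  by apply: contraNneq D0 => ->; rewrite a0 !mul0r subr0.
have mk : measurable_fun setT
    (fun z : R * R => f (a * z.1 + b * z.2 + p, c * z.1 + d * z.2 + q)%R) by meas.
have D0' : (b * c - a * d != 0)%R by rewrite -opprB oppr_eq0.
rewrite (leb_swap mk (fun=> f0 _)) (affine2_pivot p q b0 D0' mf f0) distrC.
congr (_ * _); apply: eq_integral => y _.
by apply: eq_integral => x _; congr (f (_, _)); congr (_ + _)%R; rewrite addrC.
Qed.

Let swap12 P : E3 R := (P.1.2, P.1.1, P.2).
Let swap23 P : E3 R := (P.1.1, P.2, P.1.2).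

Let vol_swap12 (f : E3 R -> \bar R) : measurable_fun setT f ->
  (forall x, 0 <= f x) -> \int[@vol R]_P f P = \int[@vol R]_P f (swap12 P).
Proof.
move=> mf f0.
have mg : measurable_fun setT (fun P => f (swap12 P)) by rewrite /swap12; meas.
rewrite (vol_tonelli mf f0) (vol_tonelli mg (fun=> f0 _)).
exact: (leb_swap12 mf f0).
Qed.

Let vol_swap23 (f : E3 R -> \bar R) : measurable_fun setT f ->
  (forall x, 0 <= f x) -> \int[@vol R]_P f P = \int[@vol R]_P f (swap23 P).
Proof.
move=> mf f0.
have mg : measurable_fun setT (fun P => f (swap23 P)) by rewrite /swap23; meas.
rewrite (vol_tonelli mf f0) (vol_tonelli mg (fun=> f0 _)).
exact: (leb_swap23 mf f0).
Qed.

(** One more elimination step: substitute in x for fixed (y, z), and then apply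
    the planar formula, with a translation depending on x, to (y, z). *)
Let vol_linear_pivot u v w (f : E3 R -> \bar R) :
  (u.1.1 != 0)%R -> (det3 u v w != 0)%R ->
  measurable_fun setT f -> (forall x, 0 <= f x) ->
  \int[@vol R]_P f P =
  `|det3 u v w|%:E * \int[@vol R]_P f (dot P u, dot P v, dot P w).
Proof.
case: u v w => [[a1 b1] c1] [[a2 b2] c2] [[a3 b3] c3] /= a0 D0 mf f0.
pose b2' := (b2 - a2 * b1 / a1)%R; pose c2' := (c2 - a2 * c1 / a1)%R.
pose b3' := (b3 - a3 * b1 / a1)%R; pose c3' := (c3 - a3 * c1 / a1)%R.
have DE : (det3 (a1, b1, c1) (a2, b2, c2) (a3, b3, c3) =
    a1 * (b2' * c3' - c2' * b3'))%R.
  by rewrite det3E/= /b2' /c2' /b3' /c3'; field.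
have D0' : (b2' * c3' - c2' * b3' != 0)%R.
  by move: D0; rewrite DE mulf_eq0 negb_or => /andP[].
pose g P := f (P.1.1, b2' * P.1.2 + c2' * P.2 + a2 / a1 * P.1.1,
                      b3' * P.1.2 + c3' * P.2 + a3 / a1 * P.1.1)%R.
have mg : measurable_fun setT g by rewrite /g; meas.
have g0 P : 0 <= g P by exact: f0.
pose h P := f (a1 * P.1.1 + b1 * P.1.2 + c1 * P.2,
  a2 * P.1.1 + b2 * P.1.2 + c2 * P.2, a3 * P.1.1 + b3 * P.1.2 + c3 * P.2)%R.
have mh : measurable_fun setT h by rewrite /h; meas.
have h0 P : 0 <= h P by exact: f0.
have -> : \int[@vol R]_P f P = `|b2' * c3' - c2' * b3'|%:E * \int[@vol R]_P g P.
  rewrite (vol_tonelli mf f0) (vol_tonelli mg g0).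
  rewrite -ge0_integralZl; [|exact: measurableT|exact: measurable_int12| |by rewrite lee_fin]; last first.
    by move=> x _; apply: integral_ge0 => y _; exact: integral_ge0.
  apply: eq_integral => x _.
  have mfx : measurable_fun setT (fun p : R * R => f (x, p.1, p.2)) by meas.
  exact: (leb_affine2 (a2 / a1 * x) (a3 / a1 * x) D0' mfx (fun=> f0 _)).
rewrite DE normrM (mulrC `|a1|%R) EFinM -muleA; congr (_ * _).
transitivity (`|a1|%:E * \int[@vol R]_P h P); last first.
  congr (_ * _); apply: eq_integral => P _; rewrite /h /dot/=.
  by congr (f (_, _, _)); ring.
pose rot (k : E3 R -> \bar R) P := k (P.2, P.1.1, P.1.2).
have rotE (k : E3 R -> \bar R) : measurable_fun setT k -> (forall x, 0 <= k x) ->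
    \int[@vol R]_P k P = \int[mu]_y \int[mu]_z \int[mu]_x rot k (y, z, x).
  move=> mk k0; rewrite (vol_tonelli mk k0) (leb_swap12 mk k0).
  have mk' : measurable_fun setT (fun P : E3 R => k (P.1.2, P.1.1, P.2)) by meas.
  exact: (leb_swap23 mk' (fun=> k0 _)).
have mrot k : measurable_fun setT k -> measurable_fun setT (rot k).
  by move=> mk; rewrite /rot; meas.
rewrite (rotE _ mg g0) (rotE _ mh h0).
rewrite -ge0_integralZl; [|exact: measurableT| | |by rewrite lee_fin]; last 2 first.
- by apply: measurable_int12; [exact: mrot|move=> P; exact: h0].
- move=> x _; apply: integral_ge0 => y _; apply: integral_ge0 => z _; exact: h0.
apply: eq_integral => y _.
rewrite -ge0_integralZl; [|exact: measurableT| | |by rewrite lee_fin]; last 2 first.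
- apply: (measurable_fun_fubini_tonelli_F (fun p => rot h (y, p.1, p.2))).
    by have := mrot _ mh => mrh; meas.
  by move=> p; exact: h0.
- by move=> x _; apply: integral_ge0 => z _; exact: h0.
apply: eq_integral => z _.
have mgyz : measurable_fun setT (fun x => g (x, y, z)) by meas.
rewrite [LHS](leb_affine (b1 * y + c1 * z) a0 mgyz (fun=> g0 _)).
congr (_ * _); apply: eq_integral => x _.
rewrite /rot /g /h /b2' /b3' /c2' /c3' /=.
congr (f (_, _, _)); first by rewrite addrA.
- by field.
- by field.
Qed.

(** A nonzero determinant leaves a nonzero entry in the first row; permuting the
    coordinates of P makes it the pivot and changes at most the sign of the
    determinant. *)
Lemma vol_linear u v w (f : E3 R -> \bar R) : (det3 u v w != 0)%R ->
  measurable_fun setT f -> (forall x, 0 <= f x) ->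
  \int[@vol R]_P f P =
  `|det3 u v w|%:E * \int[@vol R]_P f (dot P u, dot P v, dot P w).
Proof.
move=> D0 mf f0.
have mdot u' v' w' : measurable_fun setT (fun P => f (dot P u', dot P v', dot P w')).
  by rewrite /dot; meas.
have vol_linear12 u' v' w' : (u'.1.2 != 0)%R -> (det3 u' v' w' != 0)%R ->
    \int[@vol R]_P f P =
    `|det3 u' v' w'|%:E * \int[@vol R]_P f (dot P u', dot P v', dot P w').
  move=> a0 D0'.
  have DE : (det3 (swap12 u') (swap12 v') (swap12 w') = - det3 u' v' w')%R.
    by rewrite !det3E/=; ring.
  have D0s : (det3 (swap12 u') (swap12 v') (swap12 w') != 0)%R.
    by rewrite DE oppr_eq0.
  rewrite (vol_linear_pivot _ D0s mf f0)//.
  rewrite DE normrN; congr (_ * _).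
  rewrite [RHS](vol_swap12 (mdot _ _ _) (fun=> f0 _)).
  by apply: eq_integral => P _; rewrite /dot/=; congr (f (_, _, _)); ring.
have [a0|a0] := eqVneq u.1.1 0%R; last exact: vol_linear_pivot.
have [b0|b0] := eqVneq u.1.2 0%R; last exact: vol_linear12.
have c0 : (u.2 != 0)%R.
  by apply: contraNneq D0 => c0; rewrite det3E a0 b0 c0 !mul0r subr0 addr0.
have DE : (det3 (swap23 u) (swap23 v) (swap23 w) = - det3 u v w)%R.
  by rewrite !det3E/=; ring.
have D0s : (det3 (swap23 u) (swap23 v) (swap23 w) != 0)%R.
  by rewrite DE oppr_eq0.
rewrite (vol_linear12 _ _ _ _ D0s)//.
rewrite DE normrN; congr (_ * _).
rewrite [RHS](vol_swap23 (mdot _ _ _) (fun=> f0 _)).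
by apply: eq_integral => P _; rewrite /dot/=; congr (f (_, _, _)); ring.
Qed.

End linear_substitutions.

(** * Surface measure of the sphere *)

Section surface.
Context (R : realType).
Local Notation sigma := (@surface_measure R).
Local Notation S2 := (sphere R).
Local Notation direction := (@direction R).
Local Notation pball := (@pball R).
Implicit Types (u v w p q r P : E3 R) (k : R).

(** The solid cone over A is the set of points of the punctured unit ball whose
    direction lies in A. *)
Lemma surface_measureE A : sigma A = (3%:E * vol (direction @^-1` A `&` pball))%E.
Proof.
rewrite /surface_measure; congr (_ * vol _)%E.
apply/seteqP; split => [x [t /= + [u [Su Au] <-]]|x [Ax /andP[x0 x1]]].
  rewrite in_itv/= => /andP[t0 t1].
  have Ntu : enorm (t *: u) = t by rewrite enormZ gtr0_norm// Su mulr1.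
  rewrite /direction /pball /= Ntu scalerA mulVf ?gt_eqF// scale1r.
  by split => //; rewrite t0.
exists (enorm x); first by rewrite /= in_itv/= x0.
exists (direction x); last by rewrite /direction scalerA mulfV ?gt_eqF// scale1r.
by split => //; apply: direction_sphere; rewrite gt_eqF.
Qed.

Local Open Scope ereal_scope.

Lemma surface_integralE (f : E3 R -> \bar R) :
  measurable_fun setT f -> (forall x, 0 <= f x) ->
  \int[sigma]_u f u = 3%:E * \int[@vol R]_(x in pball) f (direction x).
Proof.
move=> mf f0.
have mfd : measurable_fun setT (f \o direction).
  exact: measurableT_comp mf (@measurable_direction R).
pose m : {measure set (E3 R) -> \bar R} :=
  mscale (NngNum (ler0n R 3)) (measure_function_pushforward__canonical__measure_function_Measure
    (mrestr (@vol R) (@measurable_pball R)) (@measurable_direction R)).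
transitivity (\int[m]_u f u).
  by apply: eq_measure_integral => A mA _; exact: surface_measureE.
rewrite ge0_integral_mscale; [|exact: measurableT|exact: mf|by []].
rewrite [_%:E](_ : _ = 3%:E); last by [].
rewrite ge0_integral_pushforward; [|exact: (@measurable_direction R)|exact: measurableT|exact: mf|by []].
rewrite preimage_setT.
by rewrite (ge0_integral_mrestr (@vol R) (@measurable_pball R) mfd (fun=> f0 _)).
Qed.

Lemma surface_measure_sphereC : sigma (~` S2) = 0.
Proof.
rewrite surface_measureE (_ : _ `&` _ = set0) ?measure0 ?mule0//.
apply/seteqP; split => // x /= [nS /andP[x0 _]]; apply: nS.
by apply: direction_sphere; rewrite gt_eqF.
Qed.

Lemma integral_sphere (f : E3 R -> \bar R) :
  measurable_fun setT f -> (forall x, 0 <= f x) ->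
  \int[sigma]_(u in S2) f u = \int[sigma]_u f u.
Proof.
move=> mf f0; rewrite [RHS](ge0_negligible_integral (measurableC (@measurable_sphere R))
  measurableT mf (fun x _ => f0 x) surface_measure_sphereC).
by rewrite setTD setCK.
Qed.

(** A linear isometry preserves the punctured ball and commutes with taking
    directions, and it preserves volume. *)
Lemma surface_isometry p q r (f : E3 R -> \bar R) :
  let O u : E3 R := (dot u p, dot u q, dot u r) in
  (forall u, dot (O u) (O u) = dot u u) -> (`|det3 p q r| = 1)%R ->
  measurable_fun setT f -> (forall u, 0 <= f u) ->
  \int[sigma]_u f u = \int[sigma]_u f (O u).
Proof.
move=> O dotO detO mf f0.
have mO : measurable_fun setT O by rewrite /O /dot; meas.
have mfO : measurable_fun setT (fun u => f (O u)) := measurableT_comp mf mO.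
have D0 : (det3 p q r != 0)%R by rewrite -normr_gt0 detO ltr01.
have mpatch (g : E3 R -> \bar R) : measurable_fun setT g ->
    measurable_fun setT ((g \o direction) \_ pball).
  move=> mg; apply/(measurable_restrict _ (@measurable_pball R)); first by [].
  by apply: measurable_funTS; exact: measurableT_comp mg (@measurable_direction R).
rewrite (surface_integralE mf f0) (surface_integralE mfO (fun=> f0 _)).
congr (_ * _).
rewrite [LHS]integral_mkcond [RHS]integral_mkcond.
have F0 P : 0 <= ((f \o direction) \_ pball) P.
  by rewrite patchE; case: ifP => // _; exact: f0.
rewrite (vol_linear D0 (mpatch _ mf) F0) detO mul1e.
apply: eq_integral => P _; rewrite -/(O P).
have eO : enorm (O P) = enorm P by rewrite /enorm dotO.
rewrite !patchE /=.
have -> : (O P \in pball) = (P \in pball).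
  by apply/idP/idP; rewrite !inE /pball/= eO.
case: ifP => // _; congr f; rewrite /direction eO.
rewrite !scaleE3 /O /dot/=.
by congr (_, _, _); ring.
Qed.

Lemma surface_opp (f : E3 R -> \bar R) :
  measurable_fun setT f -> (forall u, 0 <= f u) ->
  \int[sigma]_u f u = \int[sigma]_u f (- u)%R.
Proof.
move=> mf f0.
rewrite (@surface_isometry (-1, 0, 0)%R (0, -1, 0)%R (0, 0, -1)%R f _ _ mf f0).
- apply: eq_integral => u _; congr f; case: u => [[a b] c].
  by rewrite oppE3 /dot/= !mulr0 !mulrN1 !addr0 !add0r.
- by move=> u; rewrite /dot/=; ring.
- by rewrite (_ : det3 _ _ _ = -1)%R ?normrN1// det3E/=; ring.
Qed.

Lemma surface_opp_sphere (f : E3 R -> \bar R) : measurable_fun setT f ->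
  \int[sigma]_(u in S2) f (- u)%R = \int[sigma]_(u in S2) f u.
Proof.
have pos (g : E3 R -> \bar R) : measurable_fun setT g -> (forall u, 0 <= g u) ->
    \int[sigma]_(u in S2) g (- u)%R = \int[sigma]_(u in S2) g u.
  move=> mg g0; rewrite (integral_sphere mg g0) (surface_opp mg g0).
  by rewrite (integral_sphere (measurableT_comp mg (@measurable_opp R)) (fun=> g0 _)).
move=> mf; rewrite integralE [RHS]integralE.
rewrite -(pos f^\+ (measurable_funepos mf) (funepos_ge0 f)).
rewrite -(pos f^\- (measurable_funeneg mf) (funeneg_ge0 f)).
by congr (_ - _); apply: eq_integral => u _; rewrite ?funeposE ?funenegE.
Qed.

(** The reflection in the plane orthogonal to w has determinant
    1 - k * dot w w = - 1. *)
Lemma surface_reflection (k : R) w (f : E3 R -> \bar R) :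
  (k * dot w w = 2)%R ->
  measurable_fun setT f -> (forall u, 0 <= f u) ->
  \int[sigma]_u f u = \int[sigma]_u f (u - (k * dot u w) *: w)%R.
Proof.
move=> kw mf f0; case: w kw => [[w1 w2] w3] kw.
rewrite (@surface_isometry (1 - k * w1 * w1, - k * w1 * w2, - k * w1 * w3)%R
  (- k * w2 * w1, 1 - k * w2 * w2, - k * w2 * w3)%R
  (- k * w3 * w1, - k * w3 * w2, 1 - k * w3 * w3)%R f _ _ mf f0).
- apply: eq_integral => u _; congr f; case: u => [[a b] c].
  rewrite addE3 oppE3 scaleE3 /dot/=.
  by congr (_, _, _) => /=; ring.
- move=> u; move: kw; rewrite /dot/= => kw.
  set d := (u.1.1 * w1 + u.1.2 * w2 + u.2 * w3)%R.
  transitivity (u.1.1 * u.1.1 + u.1.2 * u.1.2 + u.2 * u.2 +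
    k * d ^+ 2 * (k * (w1 * w1 + w2 * w2 + w3 * w3) - 2))%R.
    by rewrite /d; ring.
  by rewrite kw subrr mulr0 addr0.
- move: kw; rewrite /dot/= => kw.
  rewrite (_ : det3 _ _ _ = 1 - k * (w1 * w1 + w2 * w2 + w3 * w3))%R; last first.
    by rewrite det3E/=; ring.
  by rewrite kw (_ : 1 - 2 = -1)%R ?normrN1//; ring.
Qed.

(** The reflection exchanging n and the first basis vector carries one
    integrand to the other. *)
Lemma surface_zonal (n : E3 R) (g : R -> \bar R) : S2 n ->
  measurable_fun setT g -> (forall x, 0 <= g x) ->
  \int[sigma]_u g (dot u n) = \int[sigma]_u g u.1.1.
Proof.
move=> /sphereP n1 mg g0; case: n n1 => [[a b] c] n1.
have [a1|a1] := eqVneq a 1%R.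
  have b0 : (b = 0)%R by move: n1; rewrite a1 /dot/=; nra.
  have c0 : (c = 0)%R by move: n1; rewrite a1 /dot/=; nra.
  by apply: eq_integral => u _; rewrite /dot/= a1 b0 c0 !mulr0 mulr1 !addr0.
have wE : (dot ((a - 1, b, c) : E3 R) (a - 1, b, c) = 2 * (1 - a))%R.
  by move: n1; rewrite /dot/=; lra.
have a1' : (1 - a != 0)%R by rewrite subr_eq0 eq_sym.
have mg' : measurable_fun setT (fun u : E3 R => g u.1.1) by meas.
rewrite [RHS](@surface_reflection (1 - a)^-1 (a - 1, b, c)%R _ _ mg' (fun=> g0 _)); last first.
  by rewrite wE; field.
apply: eq_integral => u _; rewrite addE3 oppE3 scaleE3 /dot/=; congr g.
by field.
Qed.

End surface.

(** * Integrals over the line *)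

Section line_integrals.
Context (R : realType).
Local Notation mu := (@leb R).
Implicit Types (a s t x : R).

(** Both measures have the same measurable sets, but they live on types with
    different displays; the identity map transports one to the other. *)
Lemma leb_integralE (f : R -> \bar R) (D : set R) : measurable D ->
  measurable_fun D f -> (forall x, D x -> 0 <= f x)%E ->
  (\int[mu]_(x in D) f x = \int[@lebesgue_measure R]_(x in D) f x)%E.
Proof.
move=> mD mf f0.
have mid : measurable_fun setT (idfun : R -> measurableTypeR R).
  by move=> _ A mA; rewrite setTI.
rewrite -[LHS](@ge0_integral_pushforward _ _ _ _ R _ mid mu D f)//.
by move=> x; rewrite inE; exact: f0.
Qed.

Lemma leb_even (f : R -> \bar R) : measurable_fun setT f ->
  (forall x, 0 <= f x)%E -> (forall x, f (- x) = f x) ->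
  (\int[mu]_x f x = 2%:E * \int[mu]_(x in `[0%R, +oo[) f x)%E.
Proof.
move=> mf f0 fN.
have mf' A : measurable_fun A f by exact: measurable_funS mf.
have E : (\int[mu]_(x in `]-oo, 0%R]) f x = \int[mu]_(x in `[0%R, +oo[) f x)%E.
  rewrite !leb_integralE// (ge0_integration_by_substitution0 mf f0).
  by congr integral; apply/funext => x; rewrite fN.
have -> : [set: R] = `]-oo, 0%R[ `|` `[0%R, +oo[.
  apply/seteqP; split => // x _ /=; rewrite !in_itv/= andbT.
  by case: (ltP x 0); [left|right].
rewrite ge0_integral_setU//; last first.
  rewrite disj_set2E; apply/eqP/seteqP; split => // x /=; rewrite !in_itv/= andbT.
  by case=> h1 h2; move: h1; rewrite ltNge h2.
(* The two half-lines share the point 0, which is null. *)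
rewrite [X in (X + _)%E](_ : _ = \int[mu]_(x in `]-oo, 0%R]) f x)%E; last first.
  by rewrite !leb_integralE// (integral_itv_bndo_bndc (mf' _)).
by rewrite E -[2]/(1 + 1)%R EFinD ge0_muleDl// mul1e.
Qed.

Lemma cvgy_inv_bound (F : R -> R) (l : R) :
  (forall t, 0 < t -> `|l - F t| <= t^-1) -> F t @[t --> +oo] --> l.
Proof.
move=> H; apply/cvgrPdist_lt => e e0; near=> t.
have t0 : 0 < t by near: t; exact: nbhs_pinfty_gt.
apply: (le_lt_trans (H _ t0)).
rewrite invf_plt ?posrE//; near: t.
by apply: nbhs_pinfty_gt; rewrite num_real.
Unshelve. all: by end_near. Qed.

Lemma leb_FTC_even (f F : R -> R) (l : R) :
  continuous f -> (forall x, 0 <= f x) -> (forall x, f (- x) = f x) ->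
  (forall x, is_derive x 1 F (f x)) -> F 0 = 0 ->
  F t @[t --> +oo] --> l ->
  (\int[mu]_x (f x)%:E = (2 * l)%:E)%E.
Proof.
move=> cf f0 fN dF F0 bF.
rewrite leb_even; last 3 first.
- by apply/measurable_EFinP; exact: continuous_measurable_fun.
- by move=> x; rewrite lee_fin.
- by move=> x; rewrite fN.
rewrite leb_integralE//; last 2 first.
- by apply/measurable_EFinP; apply: measurable_funTS; exact: continuous_measurable_fun.
- by move=> x _; rewrite lee_fin.
rewrite (@ge0_continuous_FTC2y _ f F 0 l)//.
- by rewrite F0 sube0.
- exact: continuous_subspaceT.
- apply: cvg_at_right_filter.
  by apply: differentiable_continuous; apply/derivable1_diffP; exact: ex_derive.
- by move=> x _; rewrite derive1E; exact: derive_val.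
Qed.

Definition hypot a s := Num.sqrt (a ^+ 2 + s ^+ 2).

Lemma hypot1_gt0 s : 0 < hypot 1 s.
Proof. by rewrite sqrtr_gt0 ltr_pwDl ?expr1n ?sqr_ge0. Qed.

Lemma hypot_gt0 a s : 0 < a -> 0 < hypot a s.
Proof. by move=> a0; rewrite sqrtr_gt0 ltr_pwDl ?sqr_ge0// exprn_gt0. Qed.

Lemma hypot1E s : hypot 1 s ^+ 2 = 1 + s ^+ 2.
Proof. by rewrite sqr_sqrtr ?expr1n// addr_ge0 ?sqr_ge0. Qed.

Lemma hypotN a s : hypot a (- s) = hypot a s.
Proof. by rewrite /hypot sqrrN. Qed.

Lemma hypotM a s : 0 <= a -> hypot a (a * s) = a * hypot 1 s.
Proof.
move=> a0; rewrite /hypot exprMn -{1}(mulr1 (a ^+ 2)) -mulrDr expr1n.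
by rewrite sqrtrM ?sqr_ge0// sqrtr_sqr ger0_norm.
Qed.

Lemma measurable_hypot d (T : measurableType d) (f g : T -> R) :
  measurable_fun setT f -> measurable_fun setT g ->
  measurable_fun setT (fun p : T => hypot (f p) (g p)).
Proof.
move=> mf mg; rewrite /hypot; apply: measurableT_comp.
  by apply: continuous_measurable_fun; exact: sqrt_continuous.
by apply: measurable_funD; exact: measurable_funX.
Qed.

Lemma is_derive_hypot1 s : is_derive s 1 (hypot 1) (s / hypot 1 s).
Proof.
have h : 0 < 1 ^+ 2 + s ^+ 2 by rewrite ltr_pwDl ?expr1n ?sqr_ge0.
have d1 : is_derive s 1 (fun x : R => 1 ^+ 2 + x ^+ 2) (2 * s).
  have -> : (fun x : R => 1 ^+ 2 + x ^+ 2) = cst (1 ^+ 2) + (@idfun R) ^+ 2.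
    by [].
  apply: is_derive_eq; rewrite [LHS]add0r.
  by rewrite -[LHS]/(2 * s ^+ 1 * 1) expr1 mulr1.
have := @is_derive1_comp _ Num.sqrt (fun x : R => 1 ^+ 2 + x ^+ 2) s _ _ (is_derive1_sqrt h) d1.
rewrite /hypot => H; apply: (is_derive_eq H).
have := hypot1_gt0 s; rewrite /hypot => h0.
by field; rewrite gt_eqF.
Qed.

Lemma is_derive_hypot1V s :
  is_derive s 1 (fun x => (hypot 1 x)^-1) (- s * (hypot 1 s)^-1 ^+ 3).
Proof.
have h0 := hypot1_gt0 s.
apply: (is_derive_eq (is_deriveV _ (is_derive_hypot1 s))).
  by rewrite gt_eqF.
by change (@GRing.scale _ _) with (@GRing.mul R); field; rewrite gt_eqF.
Qed.

Lemma continuous_hypot1V : continuous (fun x => (hypot 1 x)^-1).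
Proof.
move=> x; apply: differentiable_continuous; apply/derivable1_diffP.
by have := is_derive_hypot1V x => ?; exact: ex_derive.
Qed.

Lemma continuous_hypot1VX n : continuous (fun x => (hypot 1 x)^-1 ^+ n).
Proof.
move=> x; apply: (@continuous_comp _ _ _ (fun x => (hypot 1 x)^-1) (fun y => y ^+ n)).
  exact: continuous_hypot1V.
exact: exprn_continuous.
Qed.

Lemma le_hypot1 s : 0 <= s -> s <= hypot 1 s.
Proof.
move=> s0; rewrite -(ler_pXn2r (_ : 0 < 2)%N) ?nnegrE ?sqrtr_ge0//.
by rewrite hypot1E; lra.
Qed.

Lemma integral_hypot1V2 : (\int[mu]_s ((hypot 1 s)^-1 ^+ 2)%:E = pi%:E)%E.
Proof.
have -> : (pi = 2 * (pi / 2) :> R) by field.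
apply: (@leb_FTC_even _ (@atan R)).
- exact: continuous_hypot1VX.
- by move=> x; rewrite sqr_ge0.
- by move=> x; rewrite hypotN.
- move=> x; apply: (is_derive_eq (is_derive1_atan x)).
  by rewrite -hypot1E exprVn.
- exact: atan0.
- exact: cvgy_atan.
Qed.

Lemma integral_hypot1V3 : (\int[mu]_s ((hypot 1 s)^-1 ^+ 3)%:E = 2%:E)%E.
Proof.
have -> : (2 = 2 * 1 :> R) by rewrite mulr1.
apply: (@leb_FTC_even _ (fun x => x * (hypot 1 x)^-1)).
- exact: continuous_hypot1VX.
- by move=> x; rewrite exprn_ge0// invr_ge0 sqrtr_ge0.
- by move=> x; rewrite hypotN.
- move=> x; have H := is_derive_hypot1V x.
  have -> : (fun x => x * (hypot 1 x)^-1) = (@idfun R) * (fun x => (hypot 1 x)^-1) by [].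
  apply: is_derive_eq.
  change (@GRing.scale _ _) with (@GRing.mul R); rewrite /= mulr1.
  have h0 := hypot1_gt0 x; have hE := hypot1E x.
  have -> : x * (- x * (hypot 1 x)^-1 ^+ 3) = - (x ^+ 2) * (hypot 1 x)^-1 ^+ 3 by ring.
  have -> : x ^+ 2 = hypot 1 x ^+ 2 - 1 by rewrite hE; ring.
  by field; rewrite gt_eqF.
- by rewrite mul0r.
- apply: cvgy_inv_bound => t t0; have h0 := hypot1_gt0 t; have th := le_hypot1 (ltW t0).
  rewrite ger0_norm ?subr_ge0; last by rewrite ler_pdivrMr// mul1r.
  have hE := hypot1E t.
  have -> : 1 - t / hypot 1 t = (hypot 1 t - t) / hypot 1 t by field; rewrite gt_eqF.
  by rewrite ler_pdivrMr// ler_pdivlMl//; nra.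
Qed.

Lemma integral_hypot1V4 : (\int[mu]_s ((hypot 1 s)^-1 ^+ 4)%:E = (pi / 2)%:E)%E.
Proof.
have -> : (pi / 2 = 2 * (pi / 4) :> R) by field.
apply: (@leb_FTC_even (fun s => (hypot 1 s)^-1 ^+ 4)
  (fun x => 2^-1 * (x * (hypot 1 x)^-1 ^+ 2 + atan x))).
- exact: continuous_hypot1VX.
- by move=> x; rewrite exprn_ge0// invr_ge0 sqrtr_ge0.
- by move=> x; rewrite hypotN.
- move=> x; have H := is_derive_hypot1V x.
  have -> : (fun x => 2^-1 * (x * (hypot 1 x)^-1 ^+ 2 + atan x)) =
    2^-1 *: ((@idfun R) * (fun x => (hypot 1 x)^-1) ^+ 2 + @atan R) by [].
  apply: is_derive_eq.
  change (@GRing.scale _ _) with (@GRing.mul R); rewrite /= mulr1.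
  have h0 := hypot1_gt0 x; have hE := hypot1E x.
  rewrite -hE; set r := hypot 1 x in h0 hE *.
  have -> : ((fun y => (hypot 1 y)^-1) ^+ 2) x = r^-1 ^+ 2 by [].
  have -> : x * (2 * r^-1 ^+ 1 * (- x * r^-1 ^+ 3)) = - 2 * x ^+ 2 * r^-1 ^+ 4 by ring.
  have -> : x ^+ 2 = r ^+ 2 - 1 by rewrite hE; ring.
  by field; rewrite gt_eqF.
- by rewrite mul0r atan0 addr0 mulr0.
- have -> : pi / 4 = 2^-1 * (0 + pi / 2) :> R by field.
  apply: cvgMr; apply: cvgD; last exact: cvgy_atan.
  apply: cvgy_inv_bound => t t0; have h0 := hypot1_gt0 t; have th := le_hypot1 (ltW t0).
  rewrite sub0r normrN ger0_norm; last first.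
    by rewrite mulr_ge0 ?ltW// exprn_gt0// invr_gt0.
  rewrite exprVn ler_pdivrMr ?exprn_gt0// ler_pdivlMl//.
  by rewrite -expr2 ler_pXn2r// nnegrE ltW.
Qed.

Lemma integral_sqr_ball (r : R) : 0 < r ->
  (\int[mu]_x (if `|x| <= r then x ^+ 2 else 0)%:E = (2 / 3 * r ^+ 3)%:E)%E.
Proof.
move=> r0.
transitivity (\int[mu]_(x in `[(- r)%R, r]) (x ^+ 2)%:E)%E.
  rewrite [RHS]integral_mkcond; apply: eq_integral => x _.
  by rewrite patchE mem_setE in_itv/= -ler_norml; case: ifP.
rewrite leb_integralE//; last 2 first.
- apply/measurable_EFinP; apply: measurable_funTS.
  by apply: continuous_measurable_fun; exact: exprn_continuous.
- by move=> x _; rewrite lee_fin sqr_ge0.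
have dF x : is_derive x 1 (fun x : R => x ^+ 3 / 3) (x ^+ 2).
  have -> : (fun x : R => x ^+ 3 / 3) = 3^-1 *: (@idfun R) ^+ 3.
    by apply/funext => y; rewrite mulrC.
  apply: is_derive_eq; change (@GRing.scale _ _) with (@GRing.mul R).
  by rewrite /= mulr1; field.
have cF : continuous (fun x : R => x ^+ 3 / 3).
  by move=> x; apply: differentiable_continuous; apply/derivable1_diffP; exact: ex_derive.
rewrite (@continuous_FTC2 _ _ (fun x : R => x ^+ 3 / 3)).
- by rewrite -EFinB; congr EFin; ring.
- by rewrite gtrN.
- by apply: continuous_subspaceT; exact: exprn_continuous.
- split.
  + by move=> x _; exact: ex_derive.
  + by apply: cvg_at_right_filter; exact: cF.
  + by apply: cvg_at_left_filter; exact: cF.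
- by move=> x _; rewrite derive1E; exact: derive_val.
Qed.

End line_integrals.

(** * Gnomonic coordinates *)

Section gnomonic.
Context (R : realType).
Local Notation direction := (@direction R).
Local Notation pball := (@pball R).
Local Notation mu := (@leb R).
Local Notation sigma := (@surface_measure R).
Implicit Types (u v w P : E3 R) (a s t x : R).

(** The point of the plane tangent to the sphere at the first basis vector, with
    coordinates (t, s) in that plane. *)
Definition gnom t s : E3 R := (1, t, s).

(** The inverse of the norm of gnom t s. *)
Definition rho t s : R := (hypot (hypot 1 t) s)^-1.

Lemma rho_gt0 t s : 0 < rho t s.
Proof. by rewrite invr_gt0 hypot_gt0// hypot1_gt0. Qed.

Lemma measurable_rho : measurable_fun setT (fun p : R * R => rho p.1 p.2).
Proof.
apply: measurable_invr => [|p]; last exact: sqrtr_ge0.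
by apply: measurable_hypot; [apply: measurable_hypot|]; meas.
Qed.

Lemma enorm_gnom t s : enorm (gnom t s) = (rho t s)^-1.
Proof.
rewrite /rho invrK /enorm {1}/hypot hypot1E; congr Num.sqrt.
by rewrite /dot /gnom/=; ring.
Qed.

Local Open Scope ereal_scope.

(** Write the integral over the punctured ball in coordinates (x, y, z) and
    substitute y = x t, z = x s, with Jacobian x^2.  The direction of
    (x, x t, x s) is rho t s *: gnom t s up to the sign of x, which an even f
    does not see, and the ball becomes |x| <= rho t s.  The integral over x is
    therefore 2/3 (rho t s)^3, and the factor 3 in the definition of the surface
    measure cancels the denominator. *)
Lemma surface_gnomonic (f : E3 R -> \bar R) :
  measurable_fun setT f -> (forall P, 0 <= f P) -> (forall P, f (- P)%R = f P) ->
  \int[sigma]_u f u =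
  2%:E * \int[mu]_t \int[mu]_s ((rho t s ^+ 3)%:E * f (rho t s *: gnom t s)).
Proof.
move=> mf f0 fN.
pose F := (f \o direction) \_ pball.
have mF : measurable_fun setT F.
  apply/(measurable_restrict _ (@measurable_pball R)) => //.
  by apply: measurable_funTS; exact: measurableT_comp mf (@measurable_direction R).
have F0 P : 0 <= F P by rewrite /F patchE; case: ifP => // _; exact: f0.
rewrite (surface_integralE mf f0) integral_mkcond -/F (vol_tonelli mF F0).
have scale3 (c a b : R) : (c *: ((1%R, a, b) : E3 R) = (c, c * a, c * b))%R.
  by change ((c * 1, c * a, c * b)%R = (c, c * a, c * b)%R); rewrite mulr1.
have mH : measurable_fun setT (fun x => \int[mu]_y \int[mu]_z F (x, y, z)).
  exact: measurable_int12.
pose g (p : R * R) := f (rho p.1 p.2 *: gnom p.1 p.2).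
have mg : measurable_fun setT g.
  have measurable_rX := measurable_rho.
  apply: (@measurableT_comp _ _ _ _ _ _ f _ (fun p : R * R => rho p.1 p.2 *: gnom p.1 p.2)%R) => //.
  rewrite (_ : (fun p => _) = fun p : R * R =>
    (rho p.1 p.2, rho p.1 p.2 * p.1, rho p.1 p.2 * p.2)%R); last first.
    by apply/funext => p; rewrite scale3.
  by meas.
have g0 p : 0 <= g p by exact: f0.
pose J (p : R * R) x : R := (if `|x| <= rho p.1 p.2 then x ^+ 2 else 0)%R.
have J0 p x : (0 <= J p x)%R by rewrite /J; case: ifP => // _; exact: sqr_ge0.
pose G (P : E3 R) := (J (P.1.2, P.2) P.1.1)%:E * g (P.1.2, P.2).
have G0 P : 0 <= G P by rewrite /G mule_ge0// lee_fin.
have mJ : measurable_fun setT (fun P : E3 R => J (P.1.2, P.2) P.1.1).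
  rewrite /J; apply: measurable_fun_ifT => //.
  - apply: measurable_fun_ler => /=.
      by apply: measurableT_comp; [exact: normr_measurable|meas].
    apply: (@measurableT_comp _ _ _ _ _ _ _ _ (fun P : E3 R => (P.1.2, P.2)) measurable_rho).
    by meas.
  - by apply: measurable_funX; meas.
have mG : measurable_fun setT G.
  by apply: emeasurable_funM; [exact/measurable_EFinP|meas].
have E1 : \int[mu]_x \int[mu]_y \int[mu]_z F (x, y, z) =
    \int[mu]_x \int[mu]_y \int[mu]_z G (x, y, z).
  have int0 (k : E3 R -> \bar R) : (forall P, 0 <= k P) ->
      forall x, 0 <= \int[mu]_y \int[mu]_z k (x, y, z).
    by move=> k0 x; apply: integral_ge0 => y _; exact: integral_ge0.
  rewrite (leb_integralD1 0%R mH (int0 _ F0)).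
  rewrite (leb_integralD1 0%R (measurable_int12 mG G0) (int0 _ G0)).
  apply: eq_integral => x; rewrite inE/= => /eqP x0.
  have mFx : measurable_fun setT (fun p : R * R => F (x, p.1, p.2)) by meas.
  have D0 : (x * x - 0 * 0 != 0)%R by rewrite mulr0 subr0 mulf_neq0.
  rewrite (leb_affine2 0 0 D0 mFx (fun=> F0 _)) mulr0 subr0.
  pose Fx p := F (x, x * p.1 + 0 * p.2 + 0, 0 * p.1 + x * p.2 + 0)%R.
  have mFx' : measurable_fun setT Fx by rewrite /Fx; meas.
  have Fx0 p : 0 <= Fx p by exact: F0.
  rewrite -[LHS]/(`|x * x|%:E * \int[mu]_y \int[mu]_z Fx (y, z)).
  rewrite -ge0_integralZl; [|exact: measurableT| | |by rewrite lee_fin]; last 2 first.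
  - exact: (measurable_fun_fubini_tonelli_F Fx).
  - by move=> y _; exact: integral_ge0.
  apply: eq_integral => t _.
  rewrite -ge0_integralZl; [|exact: measurableT| | |by rewrite lee_fin]; last 2 first.
  - by apply: (@measurableT_comp _ _ _ _ _ _ Fx _ (fun z => (t, z))) => //; meas.
  - by move=> y _; exact: Fx0.
  apply: eq_integral => s _.
  rewrite /Fx /G /F patchE /J /g /=.
  have -> : (x, x * t + 0 * s + 0, 0 * t + x * s + 0)%R = (x *: gnom t s)%R.
    by rewrite scale3; congr (_, _, _); ring.
  have r0 := rho_gt0 t s; have xp : (0 < `|x|)%R by rewrite normr_gt0.
  have eE : enorm (x *: gnom t s) = (`|x| / rho t s)%R by rewrite enormZ enorm_gnom.
  have -> : ((x *: gnom t s)%R \in pball) = (`|x| <= rho t s)%R.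
    apply/idP/idP; first by rewrite inE /pball/= eE ler_pdivrMr// mul1r => /andP[].
    by move=> xr; rewrite inE /pball/= eE ler_pdivrMr// mul1r xr divr_gt0.
  case: ifP => xr; last by rewrite mule0 mul0e.
  congr (_ * _); first by rewrite ger0_norm// -expr2 sqr_ge0.
  (* For x < 0 the direction is opposite to gnom t s, and f is even. *)
  rewrite /direction eE scalerA invf_div.
  have [xpos|xneg] := ltP 0%R x.
    by rewrite gtr0_norm// mulfVK.
  rewrite ler0_norm// -[RHS]fN -scaleNr; congr (f (_ *: _)).
  by field.
(* Move the integration over x innermost, where it only sees J. *)
rewrite E1 (leb_swap12 mG G0).
have mG' : measurable_fun setT (fun P : E3 R => G (P.1.2, P.1.1, P.2)) by meas.
rewrite (leb_swap23 mG' (fun=> G0 _)).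
pose k p := (rho p.1 p.2 ^+ 3)%:E * g p.
have k0 p : 0 <= k p.
  apply: mule_ge0 (g0 p).
  by rewrite lee_fin; apply: exprn_ge0; apply: ltW; exact: rho_gt0.
have mk : measurable_fun setT k.
  have mr3 : measurable_fun setT (fun p : R * R => (rho p.1 p.2 ^+ 3)%R).
    exact: measurable_funX measurable_rho.
  by apply: emeasurable_funM; [apply/measurable_EFinP; exact: mr3|exact: mg].
have -> : \int[mu]_t \int[mu]_s \int[mu]_x G (x, t, s) =
    \int[mu]_t \int[mu]_s ((2 / 3)%:E * k (t, s)).
  apply: eq_integral => t _; apply: eq_integral => s _.
  have EJ : \int[mu]_x (J (t, s) x)%:E = (2 / 3 * rho t s ^+ 3)%:E.
    exact: integral_sqr_ball (rho_gt0 t s).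
  have mts : measurable_fun setT (fun x => (x, t, s) : E3 R) by meas.
  have mJts : measurable_fun setT (fun x => (J (t, s) x)%:E).
    by apply/measurable_EFinP; exact: (measurableT_comp mJ mts).
  rewrite -[LHS]/(\int[mu]_x ((J (t, s) x)%:E * g (t, s))).
  rewrite ge0_integralZr; [|exact: measurableT| | |exact: g0]; last 2 first.
  - exact: mJts.
  - by move=> x _; rewrite lee_fin; exact: J0.
  by rewrite EJ /k muleA -EFinM.
have -> : \int[mu]_t \int[mu]_s ((2 / 3)%:E * k (t, s)) =
    (2 / 3)%:E * \int[mu]_t \int[mu]_s k (t, s).
  rewrite -ge0_integralZl; [|exact: measurableT| | |by rewrite lee_fin]; last 2 first.
  - exact: (measurable_fun_fubini_tonelli_F k).
  - by move=> y _; exact: integral_ge0.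
  apply: eq_integral => t _.
  rewrite ge0_integralZl; [by []|exact: measurableT| |by []|by rewrite lee_fin].
  have mtz : measurable_fun setT (fun z : R => (t, z)) by meas.
  exact: (measurableT_comp mk mtz).
rewrite muleA -EFinM (_ : 3 * (2 / 3) = 2)%R; last by field.
by [].
Qed.

End gnomonic.

(** * Integrals over the sphere *)

Section sphere_integrals.
Context (R : realType).
Local Notation mu := (@leb R).
Local Notation sigma := (@surface_measure R).
Local Notation S2 := (sphere R).
Implicit Types (u v w : E3 R) (a s t x k : R).
Local Open Scope ereal_scope.

Let r t : R := (hypot 1 t)^-1.

Let r_gt0 t : (0 < r t)%R.
Proof. by rewrite invr_gt0 hypot1_gt0. Qed.

Let measurable_rX n : measurable_fun setT (fun t => (r t ^+ n)%R).
Proof. exact: (continuous_measurable_fun (@continuous_hypot1VX R n)). Qed.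

(** Substitute s = hypot 1 t * s'. *)
Lemma integral_rhoX n t (c : R) : \int[mu]_s (r s ^+ n)%:E = c%:E ->
  \int[mu]_s (rho t s ^+ n)%:E = (hypot 1 t * r t ^+ n * c)%:E.
Proof.
move=> rc; have h0 := hypot1_gt0 t.
have mrho : measurable_fun setT (fun s => (rho t s ^+ n)%R).
  have mts : measurable_fun setT (fun s : R => (t, s)) by meas.
  apply: measurable_funX; exact: (measurableT_comp (@measurable_rho R) mts).
rewrite (leb_scale h0 mrho); last first.
  by move=> s; apply: exprn_ge0; apply: ltW; exact: rho_gt0.
have -> : \int[mu]_s (rho t (hypot 1 t * s) ^+ n)%:E = \int[mu]_s ((r t ^+ n)%:E * (r s ^+ n)%:E).
  apply: eq_integral => s _; rewrite -EFinM; congr EFin.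
  by rewrite /rho hypotM ?ltW// invfM exprMn.
rewrite ge0_integralZl; [|exact: measurableT|exact/measurable_EFinP|move=> s _|]; last 2 first.
- by rewrite lee_fin exprn_ge0// ltW.
- by rewrite lee_fin exprn_ge0// ltW.
by rewrite rc -!EFinM mulrA.
Qed.

Lemma integral_rho3 t : \int[mu]_s (rho t s ^+ 3)%:E = (2 * r t ^+ 2)%:E.
Proof.
rewrite (integral_rhoX t (integral_hypot1V3 R)); congr EFin.
by rewrite /r; field; rewrite gt_eqF// hypot1_gt0.
Qed.

Lemma integral_rho4 t : \int[mu]_s (rho t s ^+ 4)%:E = (pi / 2 * r t ^+ 3)%:E.
Proof.
rewrite (integral_rhoX t (integral_hypot1V4 R)); congr EFin.
by rewrite /r; field; rewrite gt_eqF// hypot1_gt0.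
Qed.

Let integral_rZ n (a b : R) : (0 <= a)%R -> \int[mu]_s (r s ^+ n)%:E = b%:E ->
  \int[mu]_s (a * r s ^+ n)%:E = (a * b)%:E.
Proof.
move=> a0 rb; under eq_integral do rewrite EFinM.
rewrite ge0_integralZl; [|exact: measurableT|exact/measurable_EFinP|move=> s _|]; last 2 first.
- by rewrite lee_fin exprn_ge0// ltW.
- by rewrite lee_fin.
by rewrite rb -EFinM.
Qed.

Lemma surface_measureT : sigma setT = (4 * pi)%:E.
Proof.
have := integral_cst sigma (@measurableT _ (E3 R)) 1%:E; rewrite mul1e => <-.
rewrite (surface_gnomonic (measurable_cst 1%:E)); last 2 first.
- by move=> u; rewrite lee_fin.
- by [].
have -> : \int[mu]_t \int[mu]_s ((rho t s ^+ 3)%:E * (cst 1%:E (rho t s *: gnom t s)%R)) =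
   \int[mu]_t (2 * r t ^+ 2)%:E.
  apply: eq_integral => t _; rewrite -integral_rho3; apply: eq_integral => s _.
  by rewrite mule1.
rewrite (integral_rZ _ (integral_hypot1V2 R)) -?EFinM; last by [].
by congr EFin; ring.
Qed.

Lemma surface_measure_fin_num : fin_num_fun sigma.
Proof.
move=> A mA; rewrite ge0_fin_numE//; apply: (@le_lt_trans _ _ (sigma setT)).
  by apply: le_measure; rewrite ?inE.
by rewrite surface_measureT ltry.
Qed.

Lemma surface_measure_sphere : sigma S2 = (4 * pi)%:E.
Proof.
rewrite -surface_measureT.
have := integral_cst sigma (@measurableT _ (E3 R)) 1%:E; rewrite mul1e => <-.
have := integral_cst sigma (@measurable_sphere R) 1%:E; rewrite mul1e => <-.
by rewrite integral_sphere.
Qed.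

Lemma integral_abs_coord : \int[sigma]_u `|u.1.1|%:E = (2 * pi)%:E.
Proof.
have mf : measurable_fun setT (fun u : E3 R => `|u.1.1|%:E).
  apply/measurable_EFinP; apply: measurableT_comp; [exact: normr_measurable|meas].
rewrite (surface_gnomonic mf); last 2 first.
- by move=> u; rewrite lee_fin.
- by move=> u; rewrite oppE3 normrN.
have -> : \int[mu]_t \int[mu]_s ((rho t s ^+ 3)%:E * `|(rho t s *: gnom t s).1.1|%:E) =
   \int[mu]_t (pi / 2 * r t ^+ 3)%:E.
  apply: eq_integral => t _; rewrite -integral_rho4; apply: eq_integral => s _.
  rewrite -EFinM; congr EFin; rewrite scaleE3 /= mulr1 ger0_norm ?ltW ?rho_gt0//.
  by rewrite -exprSr.
rewrite (integral_rZ _ (integral_hypot1V3 R)) -?EFinM; last by rewrite divr_ge0// pi_ge0.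
by congr EFin; field.
Qed.

(** On the sphere the integrand is the distance to the third axis.  That axis,
    unlike the first one, keeps the integrand a product of a function of t and
    a power of rho t s. *)
Lemma integral_sin_coord : \int[sigma]_u (Num.sqrt (1 - u.2 ^+ 2))%:E = (pi ^+ 2)%:E.
Proof.
have mf : measurable_fun setT (fun u : E3 R => (Num.sqrt (1 - u.2 ^+ 2))%:E).
  apply/measurable_EFinP; apply: measurableT_comp.
    by apply: continuous_measurable_fun; exact: sqrt_continuous.
  by apply: measurable_funB; [exact: measurable_cst|apply: measurable_funX; meas].
rewrite (surface_gnomonic mf); last 2 first.
- by move=> u; rewrite lee_fin sqrtr_ge0.
- by move=> u; rewrite oppE3/= sqrrN.
have -> : \int[mu]_t \int[mu]_s ((rho t s ^+ 3)%:E *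
    (Num.sqrt (1 - (rho t s *: gnom t s).2 ^+ 2))%:E) =
   \int[mu]_t (pi / 2 * r t ^+ 2)%:E.
  apply: eq_integral => t _; have h0 := hypot1_gt0 t.
  transitivity (\int[mu]_s ((hypot 1 t)%:E * (rho t s ^+ 4)%:E)).
    apply: eq_integral => s _; rewrite -!EFinM; congr EFin; rewrite scaleE3 /=.
    have rp := rho_gt0 t s.
    have -> : (1 - (rho t s * s) ^+ 2 = (rho t s * hypot 1 t) ^+ 2)%R.
      have E : ((rho t s)^-1 ^+ 2 = hypot 1 t ^+ 2 + s ^+ 2)%R.
        by rewrite /rho invrK sqr_sqrtr// addr_ge0 ?sqr_ge0.
      have E1 : (1 = rho t s ^+ 2 * (rho t s)^-1 ^+ 2 :> R)%R by field; rewrite gt_eqF.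
      by rewrite {1}E1 E; ring.
    by rewrite sqrtr_sqr ger0_norm ?mulr_ge0 ?ltW//; ring.
  rewrite ge0_integralZl; [|exact: measurableT| |move=> s _|]; last 3 first.
  - have mts : measurable_fun setT (fun s : R => (t, s)) by meas.
    apply/measurable_EFinP; apply: measurable_funX.
    exact: (measurableT_comp (@measurable_rho R) mts).
  - by rewrite lee_fin exprn_ge0// ltW// rho_gt0.
  - by rewrite lee_fin ltW.
  rewrite integral_rho4 -EFinM; congr EFin; rewrite /r.
  by field; rewrite gt_eqF.
rewrite (integral_rZ _ (integral_hypot1V2 R)) -?EFinM; last by rewrite divr_ge0// pi_ge0.
by congr EFin; field.
Qed.

Lemma integral_abs_dot (n : E3 R) : \int[sigma]_u `|dot u n|%:E = (2 * pi * enorm n)%:E.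
Proof.
have [n0|n0] := eqVneq (enorm n) 0%R.
  rewrite n0 mulr0; apply: integral0_eq => u _.
  by rewrite (enorm_eq0 n0) /dot/= !mulr0 !addr0 normr0.
have [m m1 ->] := unitize n0.
rewrite enormZ (ger0_norm (enorm_ge0 n)) (m1 : enorm m = 1%R) mulr1.
have -> : \int[sigma]_u `|dot u (enorm n *: m)|%:E =
    \int[sigma]_u ((enorm n)%:E * `|dot u m|%:E).
  apply: eq_integral => u _; rewrite dotZr normrM -EFinM.
  by rewrite ger0_norm ?enorm_ge0.
have mdot : measurable_fun setT (fun u => `|dot u m|%:E).
  apply/measurable_EFinP; apply: measurableT_comp; first exact: normr_measurable.
  exact: measurable_dotl.
rewrite ge0_integralZl; [|exact: measurableT|exact: mdot| |]; last 2 first.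
- by move=> u _; rewrite lee_fin.
- by rewrite lee_fin enorm_ge0.
have mabs : measurable_fun setT (fun x : R => `|x|%:E).
  by apply/measurable_EFinP; exact: normr_measurable.
rewrite (@surface_zonal R m (fun x => `|x|%:E) m1 mabs); last first.
  by move=> x; rewrite lee_fin.
by rewrite integral_abs_coord -EFinM; congr EFin; ring.
Qed.

Let e3 : E3 R := (0, 0, 1)%R.

(** Zonal invariance used in both directions moves the axis n to the third
    one. *)
Let surface_zonal3 (n : E3 R) (g : R -> \bar R) : S2 n ->
  measurable_fun setT g -> (forall x, 0 <= g x) ->
  \int[sigma]_u g (dot u n) = \int[sigma]_u g u.2.
Proof.
move=> n1 mg g0; rewrite (surface_zonal n1 mg g0).
have e31 : S2 e3 by apply/sphereP; rewrite /dot/= !mulr0 !add0r mulr1.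
rewrite -(surface_zonal e31 mg g0); apply: eq_integral => u _; congr g.
by rewrite /dot/= !mulr0 !add0r mulr1.
Qed.

Lemma integral_sin (n : E3 R) : S2 n ->
  \int[sigma]_u (Num.sqrt (1 - dot u n ^+ 2))%:E = (pi ^+ 2)%:E.
Proof.
move=> n1; rewrite -integral_sin_coord.
apply: (@surface_zonal3 n (fun x => (Num.sqrt (1 - x ^+ 2))%:E) n1).
  apply/measurable_EFinP; apply: measurableT_comp.
    by apply: continuous_measurable_fun; exact: sqrt_continuous.
  by apply: measurable_funB; [exact: measurable_cst|apply: measurable_funX; meas].
by move=> x; rewrite lee_fin sqrtr_ge0.
Qed.

Let surface_zonal_null (n : E3 R) (A : set R) : S2 n -> measurable A ->
  sigma [set u | A (dot u n)] = \int[sigma]_u (\1_A (dot u n))%:E.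
Proof.
move=> n1 mA; rewrite -[LHS]/(sigma ((fun u => dot u n) @^-1` A)).
rewrite -[X in sigma X](setIT) -integral_indic//; exact: measurable_dot_preimage.
Qed.

(** Gnomonic coordinates miss exactly the great circle orthogonal to the first
    axis. *)
Lemma surface_measure_great_circle (n : E3 R) : enorm n != 0%R ->
  sigma [set u | dot u n = 0%R] = 0.
Proof.
move=> n0; have [m m1 ->] := unitize n0.
rewrite (_ : [set u | _] = [set u | [set 0%R] (dot u m)]); last first.
  apply/seteqP; split => u /=; rewrite dotZr; last by move=> ->; rewrite mulr0.
  by move/eqP; rewrite mulf_eq0 (negbTE n0) => /eqP.
have m1A : measurable_fun setT (fun x : R => (\1_[set 0%R] x : R)%:E).
  by apply/measurable_EFinP; exact: measurable_indic.
rewrite (surface_zonal_null m1 (measurable_set1 0%R)).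
rewrite (surface_zonal m1 m1A); last by move=> x; rewrite lee_fin.
rewrite (@surface_gnomonic _ (fun u => (\1_[set 0%R] u.1.1)%:E)).
- rewrite [X in _ * X](_ : _ = 0) ?mule0//.
  apply: integral0_eq => t _; apply: integral0_eq => s _.
  rewrite scaleE3/= mulr1 indicE memNset ?mule0//=.
  by apply/eqP; rewrite gt_eqF// rho_gt0.
- have mc : measurable_fun setT (fun u : E3 R => u.1.1) by meas.
  exact: (measurableT_comp m1A mc).
- by move=> u; rewrite lee_fin.
- move=> u; rewrite oppE3/= !indicE; congr ((nat_of_bool _)%:R%:E).
  by apply/idP/idP; rewrite !inE/= => /eqP; rewrite ?oppr_eq0 => /eqP // ->; rewrite oppr0.
Qed.

(** The third coordinate of rho t s *: gnom t s is never 1 or - 1. *)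
Lemma surface_measure_poles (n : E3 R) : S2 n ->
  sigma [set u | (dot u n ^+ 2 = 1)%R] = 0.
Proof.
move=> n1; pose A := [set x : R | (x ^+ 2 = 1)%R].
have mA : measurable A := @measurable_sqr_eq1 R.
have m1A : measurable_fun setT (fun x : R => (\1_A x : R)%:E).
  by apply/measurable_EFinP; exact: measurable_indic.
rewrite (surface_zonal_null n1 mA).
rewrite (surface_zonal3 n1 m1A); last by move=> x; rewrite lee_fin.
rewrite (@surface_gnomonic _ (fun u => (\1_A u.2)%:E)).
- rewrite [X in _ * X](_ : _ = 0) ?mule0//.
  apply: integral0_eq => t _; apply: integral0_eq => s _.
  rewrite scaleE3/= indicE memNset ?mule0//= /A/= => E.
  have rp := rho_gt0 t s.
  have E' : ((rho t s)^-1 ^+ 2 = 1 + t ^+ 2 + s ^+ 2)%R.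
    rewrite /rho invrK sqr_sqrtr; first by rewrite hypot1E.
    by rewrite addr_ge0 ?sqr_ge0.
  have : (rho t s ^+ 2 * (1 + t ^+ 2) = 0)%R.
    transitivity (rho t s ^+ 2 * (rho t s)^-1 ^+ 2 - (rho t s * s) ^+ 2)%R.
      by rewrite E'; ring.
    by rewrite E; field; rewrite gt_eqF.
  move/eqP; rewrite mulf_eq0 expf_eq0/= gt_eqF//= -hypot1E expf_eq0/=.
  by rewrite gt_eqF// hypot1_gt0.
- have mc : measurable_fun setT (fun u : E3 R => u.2) by meas.
  exact: (measurableT_comp m1A mc).
- by move=> u; rewrite lee_fin.
- move=> u; rewrite oppE3/= !indicE; congr ((nat_of_bool _)%:R%:E).
  by apply/idP/idP; rewrite !inE/A/= sqrrN.
Qed.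

(** See the introduction: the integration over v3 gives 2 pi |v1 x v2|, and
    |v1 x v2| is the sine of the angle between v1 and v2. *)
Lemma integral_det3 :
  \int[sigma]_(v1 in S2) \int[sigma]_(v2 in S2) \int[sigma]_(v3 in S2)
    `|det3 v1 v2 v3|%:E = (8 * pi ^+ 4)%:E.
Proof.
transitivity (\int[sigma]_(v1 in S2) (cst (2 * pi ^+ 3)%:E v1)); last first.
  rewrite integral_cst; last exact: measurable_sphere.
  rewrite [X in _ * X](_ : _ = (4 * pi)%:E); last exact: surface_measure_sphere.
  by rewrite -EFinM; congr EFin; ring.
apply: eq_integral => v1; rewrite inE => v1S.
have msin : measurable_fun setT (fun u => (Num.sqrt (1 - dot u v1 ^+ 2))%:E).
  apply/measurable_EFinP; apply: measurableT_comp.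
    by apply: continuous_measurable_fun; exact: sqrt_continuous.
  apply: measurable_funB; [exact: measurable_cst|apply: measurable_funX].
  exact: measurable_dotl.
have sin0 u : 0 <= (Num.sqrt (1 - dot u v1 ^+ 2))%:E by rewrite lee_fin sqrtr_ge0.
transitivity (\int[sigma]_(v2 in S2) ((2 * pi)%:E * (Num.sqrt (1 - dot v2 v1 ^+ 2))%:E)).
  apply: eq_integral => v2; rewrite inE => v2S.
  rewrite -EFinM -enorm_cross// -integral_abs_dot.
  rewrite integral_sphere.
  - by apply: eq_integral => v3 _; rewrite det3_cross.
  - apply/measurable_EFinP; apply: measurableT_comp; first exact: normr_measurable.
    by apply: (@measurable_det3 R _ _ (cst v1) (cst v2) idfun);
      [exact: measurable_cst|exact: measurable_cst|exact: measurable_id].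
  - by move=> v3; rewrite lee_fin.
rewrite ge0_integralZl; [|exact: measurable_sphere| | |]; last 3 first.
- exact: measurable_funTS msin.
- by move=> u _; exact: sin0.
- by rewrite lee_fin mulr_ge0// pi_ge0.
rewrite (integral_sphere msin sin0) integral_sin// -EFinM /=.
by congr EFin; ring.
Qed.

End sphere_integrals.

HB.instance Definition _ (R : realType) :=
  Measure_isFinite.Build _ _ _ (@surface_measure R) (@surface_measure_fin_num R).

(** * Support function and width of a convex body *)

Section support.
Context (R : realType) (K : set (E3 R)).
Context (K_nonempty : K !=set0) (K_compact : compact K)
  (K_convex : convex_set K).
Local Notation sigma := (@surface_measure R).
Local Notation S2 := (sphere R).
Local Notation h := (support_function K).
Implicit Types (u v w x y P : E3 R).

Lemma measurable_convex_body : measurable K.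
Proof.
rewrite -[K]setCK; apply: measurableC; apply: open_measurable_E3.
apply: closed_openC; apply: compact_closed => //.
Qed.

Lemma convex_body_bounded : exists2 b : R, 0 < b &
  forall x, K x -> [/\ `|x.1.1| <= b, `|x.1.2| <= b & `|x.2| <= b].
Proof.
have [M [_ HM]] := compact_bounded K_compact.
exists (`|M| + 1); first by rewrite ltr_wpDl.
move=> x Kx; have := HM (`|M| + 1) _ x Kx.
have -> : M < `|M| + 1 by rewrite (le_lt_trans (ler_norm _))// ltrDl.
move=> /(_ isT) /=; rewrite !prod_normE/= !ge_max => /andP[/andP[-> ->] ->].
by split.
Qed.

Lemma vol_convex_body_fin : vol K \is a fin_num.
Proof.
have [b b0 Kb] := convex_body_bounded.
have mi : measurable (`[- b, b]%classic : set R) by exact: measurable_itv.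
rewrite ge0_fin_numE ?measure_ge0//.
apply: (@le_lt_trans _ _ (vol ((`[- b, b]%classic `*` `[- b, b]%classic) `*` `[- b, b]%classic))).
  apply: le_measure; rewrite ?inE; [exact: measurable_convex_body| |].
    by apply: measurableX => //; exact: measurableX.
  move=> x /Kb[x1 x2 x3]; do ![split] => /=; by rewrite in_itv/= -ler_norml.
have bb : - b <= b by lra.
rewrite (vol_box mi mi mi) (leb_itv_cc bb).
by rewrite -!EFinM ltry.
Qed.

Lemma support_max u : exists2 x, K x & (dot x u = h u /\ forall y, K y -> dot y u <= h u).
Proof.
have cK : {within K, continuous (fun x => dot x u)}.
  by apply: continuous_subspaceT; exact: continuous_dotl.
have [x Kx xmax] := compact_EVT_max K_nonempty K_compact cK.
have xm y : K y -> dot y u <= dot x u by move=> Ky; apply: xmax; rewrite inE.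
rewrite inE in Kx.
exists x => //; suff -> : h u = dot x u by [].
apply/eqP; rewrite eq_le; apply/andP; split.
  apply: ge_sup; first by exists (dot x u), x.
  by move=> _ [y Ky <-]; exact: xm.
apply: ub_le_sup; last by exists x.
by exists (dot x u) => _ [y Ky <-]; exact: xm.
Qed.

Lemma support_ge x u : K x -> dot x u <= h u.
Proof. by have [y _ [_]] := support_max u; exact. Qed.

(** The level sets of dot _ v that meet K fill an interval, because a convex
    combination of a point of K where dot _ v is minimal and one where it is
    maximal stays in K. *)
Lemma slabP v (c : R) :
  (exists2 x, K x & dot x v = c) <-> - h (- v) <= c <= h v.
Proof.
split=> [[x Kx <-]|/andP[c1 c2]].
  by rewrite support_ge// andbT lerNl -dotNr support_ge.
have [x Kx [xE _]] := support_max v.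
have [y Ky [yE _]] := support_max (- v).
have yE' : dot y v = - h (- v) by rewrite -yE dotNr opprK.
have [hh|hh] := eqVneq (h v) (- h (- v)).
  by exists x => //; apply/eqP; rewrite eq_le xE c2 hh c1.
pose d := h v + h (- v).
have d0 : 0 < d.
  by rewrite /d -[X in _ + X]opprK subr_gt0 lt_neqAle eq_sym hh (le_trans c1).
(* The weight for which t * h v + (1 - t) * - h (- v) = c. *)
pose t := (c + h (- v)) / d.
have t0 : 0 <= t by apply: divr_ge0; [move: c1; lra|exact: ltW].
have t1 : t <= 1 by rewrite ler_pdivrMr// mul1r /d lerD2r.
pose l : {i01 R} := Itv01 t0 t1.
have xK : x \in K by rewrite inE.
have yK : y \in K by rewrite inE.
have := K_convex l xK yK; rewrite inE => Kz.
exists (t *: x + (1 - t) *: y); first exact: Kz.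
rewrite dotDl !dotZl xE yE' /t /d; field.
by rewrite gt_eqF.
Qed.

(** A supremum of continuous functions is lower semicontinuous. *)
Lemma measurable_support : measurable_fun setT h.
Proof.
move=> _; apply: (measurability _ (RGenOInfty.measurableE R)) => //.
move=> /= _ [_ [a ->] <-]; rewrite setTI; apply: open_measurable_E3.
rewrite (_ : _ @^-1` _ = \bigcup_(x in K) [set u | a < dot x u]).
  apply: bigcup_open => x _.
  exact: (open_comp (fun u _ => @continuous_dotr R x u) (@open_gt R a)).
apply/seteqP; split => u /=; rewrite in_itv/= andbT.
  by have [x Kx [<- _]] := support_max u => ?; exists x.
by case=> x Kx /lt_le_trans; apply; exact: support_ge.
Qed.

Lemma measurable_supportN : measurable_fun setT (fun u => h (- u)).
Proof. exact: (measurableT_comp measurable_support (@measurable_opp R)). Qed.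

Lemma support_bounded : exists b : R, forall u, S2 u -> `|h u| <= b.
Proof.
have [b b0 Kb] := convex_body_bounded.
exists (3 * b) => u /sphere_coord[u1 u2 u3].
have [x /Kb[x1 x2 x3] [<- _]] := support_max u.
have bnd (a c : R) : `|a| <= b -> `|c| <= 1 -> `|a * c| <= b.
  by move=> ab c1; rewrite normrM -[b]mulr1 ler_pM.
rewrite /dot; apply: (le_trans (ler_normD _ _)).
have := ler_normD (x.1.1 * u.1.1) (x.1.2 * u.1.2).
have := bnd _ _ x1 u1; have := bnd _ _ x2 u2; have := bnd _ _ x3 u3.
by lra.
Qed.

Definition width u : R := h u + h (- u).

Lemma measurable_width : measurable_fun setT width.
Proof.
by apply: measurable_funD; [exact: measurable_support|exact: measurable_supportN].
Qed.

Lemma width_ge0 u : 0 <= width u.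
Proof.
have [x Kx] := K_nonempty.
have h1 := support_ge u Kx; have := support_ge (- u) Kx; rewrite dotNr /width.
by lra.
Qed.

Local Open Scope ereal_scope.

Lemma integrable_support : sigma.-integrable S2 (EFin \o h).
Proof.
apply: measurable_bounded_integrable.
- exact: measurable_sphere.
- by rewrite -ge0_fin_numE ?measure_ge0// fin_num_measure//; exact: measurable_sphere.
- by apply: measurable_funTS; exact: measurable_support.
- have [b hb] := support_bounded.
  exists b; split; first exact: num_real.
  by move=> c bc u Su /=; rewrite (le_trans (hb _ Su))// ltW.
Qed.

Lemma integral_width :
  \int[sigma]_(u in S2) (width u)%:E = (2 * mean_curvature_integral K)%:E.
Proof.
have hN : sigma.-integrable S2 (EFin \o (fun u => h (- u)%R)).
  apply: measurable_bounded_integrable.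
  - exact: measurable_sphere.
  - by rewrite -ge0_fin_numE ?measure_ge0// fin_num_measure//; exact: measurable_sphere.
  - by apply: measurable_funTS; exact: measurable_supportN.
  - have [b hb] := support_bounded.
    exists b; split; first exact: num_real.
    by move=> c bc u /sphereN Su /=; rewrite (le_trans (hb _ Su))// ltW.
have mh : measurable_fun setT (fun u => (h u)%:E).
  by apply/measurable_EFinP; exact: measurable_support.
under eq_integral do rewrite EFinD.
rewrite (integralD_EFin (@measurable_sphere R) integrable_support hN) /=.
rewrite (surface_opp_sphere mh).
have hfin := integrable_fin_num (@measurable_sphere R) integrable_support.
rewrite -[X in X + X](fineK hfin) -EFinD; congr EFin.
by rewrite mulr_natl mulr2n.
Qed.

(** The indicator of the condition that the plane through P orthogonal to u meets
    K, written with h so that its joint measurability in P and u is visible. *)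
Definition chi P u : R := if (- h (- u) <= dot P u <= h u)%R then 1%R else 0%R.

Lemma chi_ge0 P u : (0 <= chi P u)%R.
Proof. by rewrite /chi; case: ifP. Qed.

Lemma chi_eq0 P u : chi P u <> 1%R -> chi P u = 0%R.
Proof. by rewrite /chi; case: ifP. Qed.

Let slab u : set R := `[(- h (- u))%R, h u]%classic.

Let chiE P u : chi P u = \1_(slab u) (dot P u).
Proof.
rewrite /chi indicE /slab; case: ifPn => c.
  by rewrite mem_set//= in_itv.
by rewrite memNset//= in_itv; apply/negP.
Qed.

Let leb_slab u : leb (slab u) = (width u)%:E.
Proof. by rewrite leb_itv_cc ?opprK// -subr_ge0 opprK; exact: width_ge0. Qed.

(** The linear map P |-> (dot P u, dot P v, dot P w) carries the set of points P
    with chi P u = chi P v = chi P w = 1 onto a box with sides width u, width v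
    and width w. *)
Lemma volume_parallelepiped u v w : det3 u v w != 0%R ->
  (width u * width v * width w)%:E =
  \int[@vol R]_P (`|det3 u v w| * (chi P u * chi P v * chi P w))%:E.
Proof.
move=> D0.
have ms a : measurable (slab a) by exact: measurable_itv.
pose B : set (E3 R) := (slab u `*` slab v) `*` slab w.
have mB : measurable B by apply: measurableX => //; exact: measurableX.
pose f P : \bar R := (\1_B P)%:E.
have mf : measurable_fun setT f by apply/measurable_EFinP; exact: measurable_indic.
have f0 P : 0 <= f P by rewrite lee_fin.
transitivity (\int[@vol R]_P f P).
  rewrite /f integral_indic// setIT.
  rewrite [RHS](_ : _ = vol B)// (vol_box (ms u) (ms v) (ms w)).
  by rewrite !leb_slab -!EFinM.
rewrite (vol_linear D0 mf f0).
rewrite -ge0_integralZl; [|exact: measurableT| |by move=> P _; exact: f0|by rewrite lee_fin]; last first.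
  by rewrite /dot; meas.
apply: eq_integral => P _; rewrite -EFinM; congr (_ * _)%:E.
rewrite !chiE /f /B !indicE /= -!natrM !mulnb; congr (nat_of_bool _)%:R.
by rewrite !in_setX.
Qed.

Lemma measurable_chi d (T : measurableType d) (F G : T -> E3 R) :
  measurable_fun setT F -> measurable_fun setT G ->
  measurable_fun setT (fun x : T => chi (F x) (G x)).
Proof.
move=> mF mG; apply: measurable_fun_ifT => //; apply: measurable_and.
- apply: measurable_fun_ler.
    by apply: measurable_funN; exact: (measurableT_comp measurable_supportN mG).
  by rewrite /dot; meas.
- apply: measurable_fun_ler; first by rewrite /dot; meas.
  exact: (measurableT_comp measurable_support mG).
Qed.

Lemma chi_body P u : K P -> chi P u = 1%R.
Proof.
by move=> KP; rewrite /chi; have/slabP -> : exists2 x, K x & dot x u = dot P u by exists P.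
Qed.

(** If x in K lies in the plane through P orthogonal to v, the direction of x - P
    is a point of the visual solid angle orthogonal to v; it is defined because
    P is not in K. *)
Lemma omega_tildeE P : ~ K P ->
  omega_tilde (visual_solid_angle K P) = S2 `&` [set v | chi P v = 1%R].
Proof.
move=> nKP; apply/seteqP; split => v /=; rewrite /chi.
  case=> Sv [u /= [uv [Su [_ [[t t0 <-] Kt]]]]]; split => //.
  suff /slabP -> : exists2 x, K x & dot x v = dot P v by [].
  exists (P + t *: u)%R; first exact: Kt.
  by rewrite dotDl dotZl uv mulr0 addr0.
case=> Sv; case: ifP => [/slabP[x Kx xP] _|_ /eqP]; last by rewrite eq_sym oner_eq0.
split => //; have d0 : enorm (x - P)%R != 0%R.
  apply/eqP => /enorm_eq0 /eqP; rewrite subr_eq0 => /eqP xE.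
  by apply: nKP; rewrite -xE.
have [u Su uE] := unitize d0.
exists u; split.
  have : dot (x - P)%R v = 0%R by rewrite dotDl dotNl xP subrr.
  by rewrite uE dotZl => /eqP; rewrite mulf_eq0 (negbTE d0) => /eqP.
split => //; exists x; split => //; exists (enorm (x - P)%R).
  by rewrite /= in_itv/= andbT enorm_ge0.
by rewrite -uE addrC subrK.
Qed.

End support.

(** * Triples of planes that meet a convex body *)

Section integral_geometry.
Context (R : realType) (K : set (E3 R)).
Context (K_nonempty : K !=set0) (K_compact : compact K)
  (K_convex : convex_set K).
Local Notation sigma := (@surface_measure R).
Local Notation vol := (@vol R).
Local Notation S2 := (sphere R).
Local Notation E := (E3 R).
Local Notation width := (@width R K).
Local Notation chi := (@chi R K).
Local Notation M := (mean_curvature_integral K).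
Implicit Types (u v w P : E3 R).
Local Open Scope ereal_scope.

(** The density, in P and the normals u, v, w, of triples of planes through P
    that all meet K. *)
Let Phi P u v w : \bar R := (`|det3 u v w| * (chi P u * chi P v * chi P w))%:E.

Let Phi_ge0 P u v w : 0 <= Phi P u v w.
Proof. by rewrite lee_fin !mulr_ge0// chi_ge0. Qed.

Let measurable_Phi d (T : measurableType d) (F0 F1 F2 F3 : T -> E) :
  measurable_fun setT F0 -> measurable_fun setT F1 ->
  measurable_fun setT F2 -> measurable_fun setT F3 ->
  measurable_fun setT (fun x : T => Phi (F0 x) (F1 x) (F2 x) (F3 x)).
Proof.
move=> m0 m1 m2 m3.
have mc := @measurable_chi R K K_nonempty K_compact d T.
apply/measurable_EFinP; apply: measurable_funM; last first.
  by apply: measurable_funM; [apply: measurable_funM|]; exact: mc.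
apply: measurableT_comp; first exact: normr_measurable.
exact: measurable_det3.
Qed.

(** The iterated integral of Phi is cut into these steps so that each of them can
    be shown measurable jointly in the variables that remain. *)
Let triples2 u v P := \int[sigma]_w Phi P u v w.
Let triples1 u P := \int[sigma]_v triples2 u v P.
Let triples P := \int[sigma]_u triples1 u P.

Let triples2_ge0 u v P : 0 <= triples2 u v P. Proof. exact: integral_ge0. Qed.

Let triples1_ge0 u P : 0 <= triples1 u P. Proof. exact: integral_ge0. Qed.

Let triples_ge0 P : 0 <= triples P. Proof. exact: integral_ge0. Qed.

Let measurable_triples2 : measurable_fun setT (fun q : E * E * E => triples2 q.1.1 q.1.2 q.2).
Proof.
apply: (measurable_fun_fubini_tonelli_F
  (fun p : E * E * E * E => Phi p.1.2 p.1.1.1 p.1.1.2 p.2)).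
  by apply: measurable_Phi; meas.
by move=> p; exact: Phi_ge0.
Qed.

Let measurable_triples1 : measurable_fun setT (fun q : E * E => triples1 q.1 q.2).
Proof.
apply: (measurable_fun_fubini_tonelli_F
  (fun p : E * E * E => triples2 p.1.1 p.2 p.1.2)).
  have mq : measurable_fun setT (fun p : E * E * E => (p.1.1, p.2, p.1.2)) by meas.
  exact: (measurableT_comp measurable_triples2 mq).
by move=> p; exact: triples2_ge0.
Qed.

Let measurable_triples : measurable_fun setT triples.
Proof.
apply: (measurable_fun_fubini_tonelli_F (fun p : E * E => triples1 p.2 p.1)).
  have mq : measurable_fun setT (fun p : E * E => (p.2, p.1)) by meas.
  exact: (measurableT_comp measurable_triples1 mq).
by move=> p; exact: triples1_ge0.
Qed.

(** Tonelli's theorem, moving the integration over P outwards past w, v and u in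
    turn. *)
Let exchange_points_planes :
  \int[sigma]_u \int[sigma]_v \int[sigma]_w \int[vol]_P Phi P u v w =
  \int[vol]_P triples P.
Proof.
transitivity (\int[sigma]_u \int[vol]_P triples1 u P); last first.
  apply: (@fubini_tonelli _ _ _ _ R sigma vol (fun p : E * E => triples1 p.1 p.2)).
    exact: measurable_triples1.
  by move=> p; exact: triples1_ge0.
apply: eq_integral => u _.
transitivity (\int[sigma]_v \int[vol]_P triples2 u v P); last first.
  apply: (@fubini_tonelli _ _ _ _ R sigma vol (fun p : E * E => triples2 u p.1 p.2)).
    have mq : measurable_fun setT (fun p : E * E => (u, p.1, p.2)) by meas.
    exact: (measurableT_comp measurable_triples2 mq).
  by move=> p; exact: triples2_ge0.
apply: eq_integral => v _.
apply: (@fubini_tonelli _ _ _ _ R sigma vol (fun p : E * E => Phi p.2 u v p.1)).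
  by apply: measurable_Phi; meas.
by move=> p; exact: Phi_ge0.
Qed.

Let measurable_widthE : measurable_fun setT (fun u => (width u)%:E).
Proof. by apply/measurable_EFinP; exact: measurable_width. Qed.

Let width_ge0' u : (0 <= width u)%R.
Proof. exact: width_ge0. Qed.

Let integral_widthZ k : (0 <= k)%R ->
  \int[sigma]_(u in S2) (k * width u)%:E = (k * (2 * M))%:E.
Proof.
move=> k0; under eq_integral do rewrite EFinM.
rewrite ge0_integralZl; [|exact: measurable_sphere|exact: measurable_funTS measurable_widthE| |];
  last 2 first.
- by move=> u _; rewrite lee_fin width_ge0'.
- by rewrite lee_fin.
by rewrite (integral_width K_nonempty K_compact) -EFinM.
Qed.

Lemma mean_curvature_integral_ge0 : (0 <= M)%R.
Proof.
rewrite -(pmulr_rge0 _ (ltr0n R 2 : (0 < 2)%R)) -lee_fin.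
rewrite -(integral_width K_nonempty K_compact).
by apply: integral_ge0 => u _; rewrite lee_fin width_ge0'.
Qed.

Lemma mean_curvature_cube :
  \int[sigma]_(u in S2) \int[sigma]_(v in S2) \int[sigma]_(w in S2)
    (width u * width v * width w)%:E = (8 * M ^+ 3)%:E.
Proof.
have M0 := mean_curvature_integral_ge0.
transitivity (\int[sigma]_(u in S2) ((2 * M) ^+ 2 * width u)%:E); last first.
  rewrite integral_widthZ ?exprn_ge0 ?mulr_ge0//.
  by congr EFin; ring.
apply: eq_integral => u _.
transitivity (\int[sigma]_(v in S2) (width u * (2 * M) * width v)%:E); last first.
  rewrite integral_widthZ ?mulr_ge0//.
  by congr EFin; ring.
apply: eq_integral => v _.
rewrite integral_widthZ ?mulr_ge0//.
by congr EFin; ring.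
Qed.

Let measurable_volPhi v u : measurable_fun setT (fun w => \int[vol]_P Phi P u v w).
Proof.
apply: (measurable_fun_fubini_tonelli_F (fun p : E * E => Phi p.2 u v p.1)).
  by apply: measurable_Phi; meas.
by move=> p; exact: Phi_ge0.
Qed.

Let measurable_volPhi_w u : measurable_fun setT (fun v => \int[sigma]_w \int[vol]_P Phi P u v w).
Proof.
apply: (measurable_fun_fubini_tonelli_F (fun q : E * E => \int[vol]_P Phi P u q.1 q.2)).
  apply: (measurable_fun_fubini_tonelli_F (fun p : E * E * E => Phi p.2 u p.1.1 p.1.2)).
    by apply: measurable_Phi; meas.
  by move=> p; exact: Phi_ge0.
by move=> p; apply: integral_ge0 => P _; exact: Phi_ge0.
Qed.

Let measurable_volPhi_vw : measurable_fun setT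
  (fun u => \int[sigma]_v \int[sigma]_w \int[vol]_P Phi P u v w).
Proof.
apply: (measurable_fun_fubini_tonelli_F
  (fun q : E * E => \int[sigma]_w \int[vol]_P Phi P q.1 q.2 w)).
  apply: (measurable_fun_fubini_tonelli_F
    (fun r : E * E * E => \int[vol]_P Phi P r.1.1 r.1.2 r.2)).
    apply: (measurable_fun_fubini_tonelli_F
      (fun p : E * E * E * E => Phi p.2 p.1.1.1 p.1.1.2 p.1.2)).
      by apply: measurable_Phi; meas.
    by move=> p; exact: Phi_ge0.
  by move=> p; apply: integral_ge0 => P _; exact: Phi_ge0.
by move=> p; apply: integral_ge0 => w _; apply: integral_ge0 => P _; exact: Phi_ge0.
Qed.

Let volPhi_ge0 u v w : 0 <= \int[vol]_P Phi P u v w.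
Proof. by apply: integral_ge0 => P _; exact: Phi_ge0. Qed.

Let volPhi_w_ge0 u v : 0 <= \int[sigma]_w \int[vol]_P Phi P u v w.
Proof. by apply: integral_ge0 => w _; exact: volPhi_ge0. Qed.

Let volPhi_vw_ge0 u : 0 <= \int[sigma]_v \int[sigma]_w \int[vol]_P Phi P u v w.
Proof. by apply: integral_ge0 => v _; exact: volPhi_w_ge0. Qed.

(** The integrands width u * width v * width w and int_P Phi P u v w agree as soon
    as det3 u v w <> 0.  For u on the sphere this fails only for v = u, v = - u,
    or w on the great circle orthogonal to cross u v. *)
Lemma mean_curvature_cube_triples : (8 * M ^+ 3)%:E = \int[vol]_P triples P.
Proof.
rewrite -exchange_points_planes -mean_curvature_cube -(integral_sphere measurable_volPhi_vw volPhi_vw_ge0).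
apply: eq_integral => u; rewrite inE => Su.
rewrite -(integral_sphere (measurable_volPhi_w u) (volPhi_w_ge0 u)).
have mwu v : measurable_fun setT (fun w => (width u * width v * width w)%:E).
  apply/measurable_EFinP; apply: measurable_funM; first exact: measurable_cst.
  exact/measurable_EFinP.
apply: (@ge0_integral_off_null _ _ R sigma S2 [set v | (dot v u ^+ 2 = 1)%R]).
- exact: measurable_sphere.
- exact: (measurable_dot_preimage u (@measurable_sqr_eq1 R)).
- exact: surface_measure_poles.
- have -> : (fun v => \int[sigma]_(w in S2) (width u * width v * width w)%:E) =
      (fun v => (width u * width v * (2 * M))%:E).
    by apply/funext => v; rewrite integral_widthZ// mulr_ge0.
  apply/measurable_EFinP; apply: measurable_funM; last exact: measurable_cst.
  by apply: measurable_funM; [exact: measurable_cst|exact/measurable_EFinP].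
- exact: measurable_volPhi_w.
- by move=> v; apply: integral_ge0 => w _; rewrite lee_fin !mulr_ge0.
- exact: volPhi_w_ge0.
move=> v Sv vu.
rewrite (integral_sphere (mwu v)); last by move=> w; rewrite lee_fin !mulr_ge0.
apply: (@ge0_integral_off_null _ _ R sigma setT [set w | dot w (cross u v) = 0%R]).
- exact: measurableT.
- exact: (measurable_dot_preimage _ (measurable_set1 0%R)).
- apply: surface_measure_great_circle; apply/eqP => c0; apply: vu => /=.
  have : dot (cross u v) (cross u v) = 0%R by rewrite -enormE c0 expr0n.
  move: Su Sv => /sphereP u1 /sphereP v1.
  by rewrite dot_cross u1 v1 mulr1 => /eqP; rewrite subr_eq0 => /eqP.
- exact: mwu.
- exact: measurable_volPhi.
- by move=> w; rewrite lee_fin !mulr_ge0.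
- exact: volPhi_ge0.
move=> w _ /eqP; rewrite -det3_cross => D0.
exact: volume_parallelepiped.
Qed.

Let measurable_absdet3 u v : measurable_fun setT (fun w => `|det3 u v w|%:E).
Proof.
apply/measurable_EFinP; apply: measurableT_comp; first exact: normr_measurable.
by apply: (@measurable_det3 R _ _ (cst u) (cst v) idfun);
  [exact: measurable_cst|exact: measurable_cst|exact: measurable_id].
Qed.

Let hit P : set E := S2 `&` [set v | chi P v = 1%R].

Let triplesE P : triples P = \int[sigma]_(u in hit P) \int[sigma]_(v in hit P)
  \int[sigma]_(w in hit P) `|det3 u v w|%:E.
Proof.
rewrite /hit; set D := [set v | chi P v = 1%R].
have chi01 v : ~ D v -> chi P v = 0%R by exact: chi_eq0.
have mS u v : measurable_fun setT (fun w => Phi P u v w) by apply: measurable_Phi; meas.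
have mS2 u : measurable_fun setT (fun v => triples2 u v P).
  have mq : measurable_fun setT (fun v : E => (u, v, P)) by meas.
  exact: (measurableT_comp measurable_triples2 mq).
have mS3 : measurable_fun setT (fun u => triples1 u P).
  have mq : measurable_fun setT (fun u : E => (u, P)) by meas.
  exact: (measurableT_comp measurable_triples1 mq).
rewrite /triples -(integral_sphere mS3); last by move=> u; exact: triples1_ge0.
rewrite [RHS]integral_mkcondr; apply: eq_integral => u _; rewrite patchE.
have [uD|/negP uD] := boolP (u \in D); last first.
  apply: integral0_eq => v _; apply: integral0_eq => w _.
  by rewrite /Phi chi01 ?mul0r ?mulr0//; move=> ?; apply: uD; rewrite inE.
rewrite inE in uD.
rewrite /triples1 -(integral_sphere (mS2 u)); last by move=> v; exact: triples2_ge0.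
rewrite [RHS]integral_mkcondr; apply: eq_integral => v _; rewrite patchE.
have [vD|/negP vD] := boolP (v \in D); last first.
  apply: integral0_eq => w _.
  by rewrite /Phi (chi01 v) ?mulr0 ?mul0r ?mulr0//; move=> ?; apply: vD; rewrite inE.
rewrite inE in vD.
rewrite /triples2 -(integral_sphere (mS u v)); last by move=> w; exact: Phi_ge0.
rewrite [RHS]integral_mkcondr; apply: eq_integral => w _; rewrite patchE /Phi.
rewrite (uD : chi P u = 1%R) (vD : chi P v = 1%R) !mul1r.
have [wD|/negP wD] := boolP (w \in D); last first.
  by rewrite (chi01 w) ?mulr0//; move=> ?; apply: wD; rewrite inE.
by rewrite inE in wD; rewrite (wD : chi P w = 1%R) mulr1.
Qed.

Let triples_body P : K P -> triples P = (8 * pi ^+ 4)%:E.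
Proof.
move=> KP; rewrite triplesE -integral_det3 /hit.
have -> : [set v | chi P v = 1%R] = setT.
  by apply/seteqP; split => // v _ /=; exact: chi_body.
by rewrite setIT.
Qed.

Let triples_beta P : ~ K P -> triples P = 8%:E * beta (visual_solid_angle K P).
Proof.
move=> nKP; rewrite /beta (omega_tildeE K_nonempty K_compact K_convex nKP).
rewrite -/(hit P) -triplesE; move: (triples P) => x.
by rewrite muleA -EFinM mulfV// mul1e.
Qed.

Lemma mean_curvature_visual_angle :
  (M ^+ 3 - pi ^+ 4 * fine (vol K))%:E =
  \int[vol]_(P in ~` K) beta (visual_solid_angle K P).
Proof.
have mK : measurable K := measurable_convex_body K_compact.
have split_triples : \int[vol]_P triples P = \int[vol]_(P in K) triples P + \int[vol]_(P in ~` K) triples P.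
  have disjK : [disjoint K & ~` K] by rewrite disj_set2E setICr.
  have mtriplesK : measurable_fun (K `|` ~` K) triples by exact: measurable_funTS measurable_triples.
  have := @ge0_integral_setU _ _ R vol K (~` K) mK (measurableC mK) triples mtriplesK
    (fun P _ => triples_ge0 P) disjK.
  by rewrite setUv.
have intK : \int[vol]_(P in K) triples P = (8 * pi ^+ 4 * fine (vol K))%:E.
  transitivity (\int[vol]_(P in K) cst (8 * pi ^+ 4)%:E P).
    by apply: eq_integral => P; rewrite inE => KP; exact: triples_body.
  rewrite (integral_cst vol mK) [RHS]EFinM.
  by rewrite (fineK (vol_convex_body_fin K_compact)).
have -> : \int[vol]_(P in ~` K) beta (visual_solid_angle K P) =
    (8^-1)%:E * \int[vol]_(P in ~` K) triples P.
  rewrite -ge0_integralZl; [|exact: measurableC|exact: measurable_funTS measurable_triples| |by rewrite lee_fin];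
    last by move=> P _; exact: triples_ge0.
  apply: eq_integral => P; rewrite inE => nKP; rewrite (triples_beta nKP).
  move: (beta _) => x; by rewrite muleA -EFinM mulVf// mul1e.
have := mean_curvature_cube_triples; rewrite split_triples intK.
(* The integral is finite because the other two terms are. *)
case: (\int[vol]_(P in ~` K) triples P) => [t||] //=.
rewrite -!EFinD -EFinM => -[E0]; congr EFin.
have -> : t = (8 * M ^+ 3 - 8 * pi ^+ 4 * fine (vol K))%R by rewrite E0; ring.
by field.
Qed.

End integral_geometry.

Theorem theorem1p2 (R : realType) (K : set (E3 R)) (K_nonempty : K !=set0)
    (K_compact : compact K) (K_convex : convex_set K) :
  let M : R := mean_curvature_integral K in
  let V : R := fine (vol K) in
  (M ^+ 3 - pi ^+ 4 * V)%:E
    = (\int[@vol R]_(P in ~` K) beta (visual_solid_angle K P))%E.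
Proof. exact: mean_curvature_visual_angle. Qed.
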